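(* Fix a positive integer $r$. For any $r$-uniform hypergraph $\mathcal H=(\mathcal V,\mathcal E)$ with $|\mathcal V|=m$, $\omega_0(\mathcal H)\le m^{r+1}+o(m^{r+1})$ as $m\to\infty$ (where the error term depends only on $r$ and $m$). Moreover, this bound is attained up to a constant factor by the complete $r$-uniform hypergraph $\mathcal K^r_m$ on $m$ vertices, that is, there is a constant $c>0$ (depending only on $r$) such that $\omega_0(\mathcal K^r_m)\ge c\,m^{r+1}$ for all sufficiently large $m$.
   Context: A hypergraph is a pair $\mathcal H=(\mathcal V,\mathcal E)$ where $\mathcal V$ is a finite set (vertices) and $\mathcal E$ is a collection of (pairwise distinct) subsets of $\mathcal V$ (hyperedges). It is $r$-uniform if every hyperedge has cardinality $r$. The complete $r$-uniform hypergraph $\mathcal K^r_m$ has a vertex set of size $m$ and all $r$-element subsets of it as hyperedges. An edge-discriminator on $\mathcal H$ is a function $\lambda:\mathcal V\to\mathbb Z^{+}\cup\{0\}$ such that $\sum_{v\in E}\lambda(v)>0$ for every $E\in\mathcal E$, and $\sum_{v\in E}\lambda(v)\ne\sum_{v\in E'}\lambda(v)$ for every two distinct $E,E'\in\mathcal E$. Its weight is $\omega_\lambda(\mathcal V)=\sum_{v\in\mathcal V}\lambda(v)$. The quantity $\omega_0(\mathcal H)$ is the minimum of $\omega_\lambda(\mathcal V)$ over all edge-discriminators $\lambda$ on $\mathcal H$. *)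

(* Defs.v *)
From mathcomp Require Import all_boot.
From mathcomp Require Import boolp.

Set Implicit Arguments.
Unset Strict Implicit.
Unset Printing Implicit Defensive.

Record hypergraph := Hypergraph {
  vertices : finType;
  hyperedges : {set {set vertices}}
}.

Definition uniform (r : nat) (H : hypergraph) : Prop :=
  forall E : {set vertices H}, E \in hyperedges H -> #|E| = r.

Definition complete_hypergraph (r m : nat) : hypergraph :=
  @Hypergraph 'I_m [set E : {set 'I_m} | #|E| == r].

Definition edge_discriminator (H : hypergraph)
    (lam : {ffun vertices H -> nat}) : Prop :=
  (forall E, E \in hyperedges H -> 0 < \sum_(v in E) lam v) /\
  (forall E E', E \in hyperedges H -> E' \in hyperedges H -> E <> E' ->
     \sum_(v in E) lam v <> \sum_(v in E') lam v).

Definition weight (H : hypergraph) (lam : {ffun vertices H -> nat}) : nat :=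
  \sum_(v : vertices H) lam v.

Definition discriminator_weight (H : hypergraph) (w : nat) : Prop :=
  exists2 lam, @edge_discriminator H lam & weight lam = w.

(* The value 0 in the second branch is a junk value: it is taken only if H has
   no edge-discriminator, i.e. only if the empty set is a hyperedge of H
   (see exists_discriminator below). *)
Definition omega0 (H : hypergraph) : nat :=
  match pselect (exists w, `[< discriminator_weight H w >]) with
  | left exw => ex_minn exw
  | right _ => 0
  end.

Lemma sum_pow2_inj k (A B : {set 'I_k}) :
  \sum_(i in A) 2 ^ i = \sum_(i in B) 2 ^ i -> A = B.
Proof.
have step n (C : {set 'I_n.+1}) : \sum_(i in C) 2 ^ i =
    (ord0 \in C) + (\sum_(i in [set i | lift ord0 i \in C]) 2 ^ i).*2.
  rewrite big_mkcond big_ord_recl /= expn0; congr (_ + _).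
  rewrite -mul2n big_distrr /= [RHS]big_mkcond /=; apply: eq_bigr => i _.
  by rewrite inE; case: ifP; rewrite // -expnS.
elim: k A B => [|k IH] A B; first by move=> _; apply/setP; case.
rewrite !step => e.
have e0 : (ord0 \in A) = (ord0 \in B).
  by have := congr1 odd e; rewrite !oddD !odd_double !addbF !oddb.
move: e; rewrite e0 => /addnI /double_inj /IH eAB.
apply/setP => i; case: (unliftP ord0 i) => [j ->|-> //].
by have := congr1 (fun C : {set _} => j \in C) eAB; rewrite !inE.
Qed.

Lemma exists_discriminator (H : hypergraph) :
  set0 \notin hyperedges H <-> exists lam, @edge_discriminator H lam.
Proof.
split=> [n0|[lam [pos _]]]; last first.
  by apply/negP => /pos; rewrite big_set0.
exists [ffun v => 2 ^ enum_rank v].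
have sumE (E : {set vertices H}) :
    \sum_(v in E) [ffun v => 2 ^ enum_rank v] v =
    \sum_(i in [set enum_rank v | v in E]) 2 ^ i.
  rewrite big_imset /=; last by move=> ? ? _ _; exact: enum_rank_inj.
  by apply: eq_bigr => v _; rewrite ffunE.
split=> [E EH|E E' _ _ neq].
  case: (set_0Vmem E) => [E0|[v vE]]; first by rewrite -E0 EH in n0.
  by rewrite (bigD1 v) //= ffunE ltn_addr // expn_gt0.
by rewrite !sumE => /sum_pow2_inj /(imset_inj (@enum_rank_inj _)).
Qed.

Lemma omega0_min (H : hypergraph) : set0 \notin hyperedges H ->
  discriminator_weight H (omega0 H) /\
  (forall lam, @edge_discriminator H lam -> omega0 H <= weight lam).
Proof.
move=> /exists_discriminator [lam0 d0]; rewrite /omega0.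
case: pselect => [exw|[]]; last first.
  by exists (weight lam0); apply/asboolP; exists lam0.
case: ex_minnP => w /asboolP wP wmin; split=> // lam dlam.
by apply: wmin; apply/asboolP; exists lam.
Qed.

Lemma uniform_set0 (r : nat) (H : hypergraph) :
  0 < r -> uniform r H -> set0 \notin hyperedges H.
Proof. by move=> r0 u; apply/negP => /u; rewrite cards0 => e; rewrite -e in r0. Qed.

Lemma complete_uniform (r m : nat) : uniform r (complete_hypergraph r m).
Proof. by move=> E; rewrite inE => /eqP. Qed.

(* Main.v *)
Require Import Defs.
From HB Require Import structures.
From mathcomp Require Import all_boot all_order all_algebra.
From mathcomp Require Import all_classical all_reals all_analysis.
From mathcomp Require Import cyclic finfield ring lra zify.

(* The lower bound is a count: at least half of the vertices weigh at most 2W/m,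
   and the r-subsets of these have distinct positive weights, all at most 2rW/m.

   Upper bound (Bose and Chowla). Let q >= m be a prime power, L the field with q^r
   elements, K its subfield with q elements and g a generator of the group of units
   of L. Weigh the elements b of K by the discrete logarithms of g - b. If two
   r-subsets of K have the same weight, the polynomials prod (X - b) over the two
   subsets agree at g; their difference has degree less than r, so they are equal,
   because g has degree r over K. The total weight is at most m q^r.

   It remains to see that the least prime power q >= m is asymptotic to m. By
   Selberg's formula, the measure Lambda(n) log n + (Lambda * Lambda)(n) has mass
   2 t log x + O(x) on every interval of length t <= x near x. Suppose that (x, X]
   contains no prime power, with X - x >= delta x, and let D(n) be the number of
   prime powers, weighted by Lambda, in (x/n, X/n]. Selberg's formula on (x, X]
   shows that D(n) is close to its maximal possible value 2(X - x)/n for most prime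
   powers n, and then, on the intervals (x/n, X/n], that D(n) is close to 0 for most
   products n of two prime powers. But n D(n)/(X - x) has average 1 on long intervals
   and varies slowly, so each of them contains a short interval where it stays in
   [1/2, 3/2], and by Selberg's formula such an interval carries its share of prime
   powers and products of two prime powers.

   Sums up to x/n are sums up to the natural number x %/ n, so that
   (x %/ a) %/ b = x %/ (a * b) replaces the composition of real quotients. *)

Set Implicit Arguments.
Unset Strict Implicit.
Unset Printing Implicit Defensive.
Import Order.TTheory GRing.Theory Num.Theory numFieldNormedType.Exports.
Local Open Scope ring_scope.

(** * Divisor sums *)

Section DivisorSums.
Context {M : nmodType}.
Implicit Types (f : nat -> nat -> M) (g : nat -> M).

Lemma sum_nat_shorten g (P : pred nat) m n : (m <= n)%N ->
  (forall i, (m <= i < n)%N -> ~~ P i) ->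
  \sum_(1 <= i < n | P i) g i = \sum_(1 <= i < m | P i) g i.
Proof.
case: m => [|m] mn H.
  rewrite [RHS]big_geq // big_nat_cond big_pred0 // => i.
  by apply/negP => /andP[/andP[_ h]]; apply/negP/H.
rewrite (@big_cat_nat _ _ _ m.+1) //= [X in _ + X]big_nat_cond [X in _ + X]big_pred0 ?addr0 // => i.
by apply/negP => /andP[h]; apply/negP/H.
Qed.

(** Induction on [N]: by [divnS], the inner range on the right grows from [N] to [N.+1] exactly for
    the divisors [d] of [N.+1], by the single term [e = N.+1 %/ d]. *)
Lemma dirichlet_hyperbola f N :
  \sum_(1 <= n < N.+1) \sum_(1 <= d < n.+1 | (d %| n)%N) f d (n %/ d)%N =
  \sum_(1 <= d < N.+1) \sum_(1 <= e < (N %/ d).+1) f d e.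
Proof.
elim: N => [|N IH]; first by rewrite !big_geq.
rewrite big_nat_recr //= IH [in RHS]big_nat_recr //= divnn /= big_nat1.
have -> : \sum_(1 <= d < N.+2 | (d %| N.+1)%N) f d (N.+1 %/ d)%N =
   \sum_(1 <= d < N.+1 | (d %| N.+1)%N) f d (N.+1 %/ d)%N + f N.+1 1%N.
  by rewrite big_mkcond big_nat_recr //= dvdnn divnn /= -big_mkcond.
rewrite addrA; congr (_ + _).
rewrite [X in _ + X]big_mkcond -big_split /=; apply: eq_big_nat => d /andP[d0 dN].
rewrite divnS //; case: (d %| N.+1)%N => /=; last by rewrite add0n addr0.
by rewrite add1n [RHS]big_nat_recr.
Qed.

End DivisorSums.

(** Both sides run over the pairs with [d * e] dividing [k]. This is the exchange of summation
    behind Moebius inversion. *)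
Lemma divisor_sum_assoc (A : nmodType) (f : nat -> nat -> A) k : (0 < k)%N ->
  \sum_(1 <= d < k.+1 | (d %| k)%N) \sum_(1 <= e < (k %/ d).+1 | (e %| k %/ d)%N) f d e =
  \sum_(1 <= e < k.+1 | (e %| k)%N) \sum_(1 <= d < (k %/ e).+1 | (d %| k %/ e)%N) f d e.
Proof.
move=> k0.
have H (g : nat -> nat -> A) :
   \sum_(1 <= d < k.+1 | (d %| k)%N) \sum_(1 <= e < (k %/ d).+1 | (e %| k %/ d)%N) g d e =
   \sum_(1 <= d < k.+1) \sum_(1 <= e < k.+1 | (d * e %| k)%N) g d e.
  rewrite big_mkcond; apply: eq_big_nat => d /andP[d0 _]; case: ifPn => [dk|ndk].
    rewrite -(@sum_nat_shorten _ _ _ _ k.+1) ?ltnS ?leq_div //; last first.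
      move=> i /andP[ni _]; apply/negP => /dvdn_leq; rewrite divn_gt0 // dvdn_leq //.
      by move=> /(_ isT); lia.
    by apply: eq_bigl => e; rewrite mulnC dvdn_divRL.
  by rewrite big_pred0 // => e; apply/negP => /(dvdn_trans (dvdn_mulr _ (dvdnn d))); exact/negP.
rewrite H (H (fun d e => f e d)) [LHS](eq_bigr _ (fun d _ => big_mkcond _ _)).
rewrite [RHS](eq_bigr _ (fun d _ => big_mkcond _ _)) exchange_big_nat /=.
by apply: eq_bigr => d _; apply: eq_bigr => e _; rewrite mulnC.
Qed.

(** * The von Mangoldt and Moebius functions *)

Section VonMangoldtMoebius.
Context {R : realType}.
Implicit Types (n m d p k : nat).

(** [primes n] is a singleton exactly for the powers p^j of a prime with j >= 1; 0 and 1 get the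
    value 0. *)
Definition mangoldt n : R := if primes n is [:: p] then ln p%:R else 0.

(* [moebius 0] has the junk value 1. *)
Definition moebius n : R :=
  if all (fun p => logn p n == 1%N) (primes n) then (-1) ^+ size (primes n) else 0.

Lemma ln_nat_ge0 n : 0 <= ln n%:R :> R.
Proof. by case: n => [|n]; [rewrite ln0 | rewrite ln_ge0 // ler1n]. Qed.

Lemma mangoldt_ge0 n : 0 <= mangoldt n.
Proof. by rewrite /mangoldt; case: (primes n) => [|p []] // ; exact: ln_nat_ge0. Qed.

Lemma mangoldt1 : mangoldt 1 = 0.
Proof. by []. Qed.

Lemma mangoldt_pfactor p k : prime p -> mangoldt (p ^ k.+1) = ln p%:R.
Proof. by move=> pp; rewrite /mangoldt primesX // primes_prime. Qed.

Lemma mangoldt_neq0 n : mangoldt n != 0 -> exists p k, prime p /\ n = (p ^ k.+1)%N.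
Proof.
rewrite /mangoldt; case E: (primes n) => [|p [|//]]; rewrite ?eqxx // => _.
have pn : p \in primes n by rewrite E inE.
move: (pn); rewrite mem_primes => /and3P[pp n0 pdn].
have : p.-nat n.
  apply/pnatP => // q qp qn; have : q \in primes n by rewrite mem_primes qp n0 qn.
  by rewrite E inE.
move=> /p_natP[[|k] nE]; first by rewrite nE in E.
by exists p, k.
Qed.

(** Strong induction on n = p m with p the least prime factor: every prime power dividing n divides
    m, except the full power p^k with [k = logn p n], which contributes ln p. *)
Lemma sum_mangoldt_divisors n : (0 < n)%N ->
  \sum_(1 <= d < n.+1 | (d %| n)%N) mangoldt d = ln n%:R.
Proof.
elim/ltn_ind: n => n IH n0.
have [n1|n1] := leqP n 1.
  have -> : n = 1%N by lia.
  by rewrite big_mkcond big_nat1 /= mangoldt1 ln1.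
have pp := pdiv_prime n1; set p := pdiv n in pp.
have pn : (p %| n)%N by exact: pdiv_dvd.
set m := (n %/ p)%N; have nE : n = (p * m)%N by rewrite mulnC divnK.
have p1 := prime_gt1 pp.
have m0 : (0 < m)%N by move: n0; rewrite nE muln_gt0 => /andP[].
have mn : (m < n)%N by rewrite nE ltn_Pmull.
set k := logn p n.
have kE : k = (logn p m).+1 by rewrite /k nE lognM ?(prime_gt0 pp) // (logn_prime p pp) eqxx.
transitivity (\sum_(1 <= d < n.+1)
   ((if (d %| m)%N then mangoldt d else 0) + (if (d == p ^ k)%N then ln p%:R else 0)) : R).
  rewrite big_mkcond; apply: eq_big_nat => d /andP[d0 _].
  case: (eqVneq d (p ^ k)%N) => [->|dpk].
    rewrite pfactor_dvdn // leqnn pfactor_dvdn // kE ltnn add0r.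
    by rewrite mangoldt_pfactor.
  rewrite addr0; case: (boolP (d %| m)%N) => [dm|ndm].
    by rewrite nE dvdn_mull.
  case: ifP => // dn; apply/eqP; apply: contraNT ndm => /mangoldt_neq0[l [j [pl dE]]].
  subst d; move: dn dpk; have [->|lp] := eqVneq l p.
    rewrite !pfactor_dvdn // -/k => jk jk'.
    have : j.+1 != k by apply: contraNneq jk' => ->.
    by rewrite kE in jk *; lia.
  rewrite nE => + _; rewrite Gauss_dvdr //.
  by rewrite coprimeXl // prime_coprime // dvdn_prime2.
rewrite big_split /= -big_mkcond /= (@sum_nat_shorten _ _ _ m.+1) ?ltnS 1?ltnW //; last first.
  by move=> i /andP[i1 _]; apply/negP => /(dvdn_leq m0); lia.
rewrite IH // -big_mkcond big_nat1_eq expn_gt0 (prime_gt0 pp) /=ltnS dvdn_leq ?pfactor_dvdnn //.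
by rewrite nE natrM lnM ?posrE ?ltr0n ?(prime_gt0 pp) // addrC.
Qed.

Lemma sum_multiples (A : nmodType) (g : nat -> A) p N : (0 < p)%N ->
  \sum_(1 <= d < N.+1 | (p %| d)%N) g d = \sum_(1 <= e < (N %/ p).+1) g (p * e)%N.
Proof.
move=> p0; elim: N => [|N IH]; first by rewrite div0n !big_geq.
rewrite big_mkcond big_nat_recr //= -big_mkcond /= IH divnS //.
case: ifP => [pN|_]; last by rewrite addr0.
rewrite add1n [RHS]big_nat_recr //=; congr (_ + g _).
have <- : (N.+1 %/ p = (N %/ p).+1)%N by rewrite divnS // pN.
by rewrite mulnC divnK.
Qed.

Lemma moebius_primeM p e : prime p -> (0 < e)%N ->
  moebius (p * e) = if (p %| e)%N then 0 else - moebius e.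
Proof.
move=> pp e0; have p0 := prime_gt0 pp.
have memE q : (q \in primes (p * e)) = (q == p) || (q \in primes e).
  by rewrite primesM // primes_prime // inE.
rewrite /moebius; case: (boolP (p %| e)%N) => [pe|npe].
  case: ifP => // /allP /(_ p); rewrite memE eqxx => /(_ isT).
  rewrite lognM // (logn_prime p pp) eqxx add1n eqSS.
  by rewrite -leqn0 leqNgt logn_gt0 mem_primes pp e0 pe.
have pnp : p \notin primes e by rewrite mem_primes (negbTE npe) !andbF.
have H : perm_eq (primes (p * e)) (p :: primes e).
  by apply: uniq_perm; rewrite ?primes_uniq //= ?pnp ?primes_uniq // => q; rewrite memE inE.
rewrite (perm_size H) (perm_all _ H) /= lognM // (logn_prime p pp) eqxx.
have -> : logn p e = 0%N by apply/eqP; rewrite -leqn0 leqNgt logn_gt0.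
rewrite addn0 eqxx /= exprS mulN1r.
have -> : all (fun q => logn q (p * e) == 1%N) (primes e) = all (fun q => logn q e == 1%N) (primes e).
  apply: eq_in_all => q qe; rewrite lognM // (logn_prime _ pp).
  have -> : (q == p) = false by apply: contraNF pnp => /eqP <-.
  by rewrite add0n.
by case: ifP; rewrite ?oppr0.
Qed.

(** Let n = p m with p prime. The divisors p e with e dividing m contribute [- moebius e], or 0 if p
    divides e; they cancel term by term against the divisors prime to p, which all divide m. *)
Lemma sum_moebius_divisors n : (0 < n)%N ->
  \sum_(1 <= d < n.+1 | (d %| n)%N) moebius d = (n == 1%N)%:R.
Proof.
move=> n0; have [n1|n1] := leqP n 1.
  have -> : n = 1%N by lia.
  by rewrite big_mkcond big_nat1.
have pp := pdiv_prime n1; set p := pdiv n in pp.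
have pn : (p %| n)%N by exact: pdiv_dvd.
set m := (n %/ p)%N; have nE : n = (p * m)%N by rewrite mulnC divnK.
have p0 := prime_gt0 pp.
have m0 : (0 < m)%N by move: n0; rewrite nE muln_gt0 => /andP[].
have -> : (n == 1%N) = false by lia.
rewrite big_mkcond (bigID (fun d => p %| d)%N) /= sum_multiples // -/m.
rewrite [X in _ + X](_ : _ =
  \sum_(1 <= d < n.+1 | (d %| m)%N) (if (p %| d)%N then 0 else moebius d)); last first.
  rewrite [LHS]big_mkcond [RHS]big_mkcond; apply: eq_big_nat => d /andP[d0 _].
  case: (boolP (p %| d)%N) => /= [|npd]; first by rewrite if_same.
  by rewrite nE Gauss_dvdr // coprime_sym prime_coprime.
rewrite [X in _ + X](@sum_nat_shorten _ _ _ m.+1) ?(leq_div n p : (m.+1 <= n.+1)%N) //; last first.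
  by move=> i /andP[i1 _]; apply/negP => /(dvdn_leq m0); lia.
transitivity (\sum_(1 <= d < m.+1) ((if (p * d %| n)%N then moebius (p * d) else 0) +
   (if (d %| m)%N then if (p %| d)%N then 0 else moebius d else 0))).
  by rewrite big_split /=; congr (_ + _); rewrite big_mkcond.
rewrite big1_seq // => e.
rewrite mem_index_iota => /andP[_ /andP[e0 _]].
rewrite nE dvdn_pmul2l // moebius_primeM //.
by case: (p %| e)%N; case: (e %| m)%N; rewrite ?addr0 ?addNr.
Qed.

Lemma norm_moebius n : `|moebius n| <= 1.
Proof.
rewrite /moebius; case: ifP => _; last by rewrite normr0.
by rewrite normrX normrN1 expr1n.
Qed.

(** Moebius inversion of [sum_mangoldt_divisors]: expand the logarithm, exchange the sums, and only
    e = n survives in the inner Moebius sum. *)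
Lemma sum_moebius_ln n : (0 < n)%N ->
  \sum_(1 <= d < n.+1 | (d %| n)%N) moebius d * ln (n %/ d)%:R = mangoldt n.
Proof.
move=> n0.
transitivity (\sum_(1 <= d < n.+1 | (d %| n)%N)
   \sum_(1 <= e < (n %/ d).+1 | (e %| n %/ d)%N) (moebius d * mangoldt e)).
  rewrite big_nat_cond [RHS]big_nat_cond; apply: eq_bigr => d /andP[/andP[d0 _] dn].
  by rewrite -mulr_sumr sum_mangoldt_divisors // divn_gt0 // dvdn_leq.
rewrite (divisor_sum_assoc (fun d e => moebius d * mangoldt e)) //.
transitivity (\sum_(1 <= e < n.+1 | (e %| n)%N) (if e == n then mangoldt n else 0)).
  rewrite big_nat_cond [RHS]big_nat_cond; apply: eq_bigr => d /andP[/andP[d0 _] dn].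
  have nd0 : (0 < n %/ d)%N by rewrite divn_gt0 // dvdn_leq.
  have E : (n %/ d == 1)%N = (d == n) by rewrite -[LHS](eqn_pmul2r d0) divnK // mul1n eq_sym.
  rewrite -mulr_suml sum_moebius_divisors // E.
  by case: eqP => [->|]; rewrite ?mul1r ?mul0r.
rewrite -big_mkcondr /= (eq_bigl (fun e => e == n)).
  by rewrite big_nat1_eq n0 ltnSn.
by move=> e; case: eqP => [->|]; rewrite ?dvdnn ?andbF.
Qed.

End VonMangoldtMoebius.

(** * Estimates of Chebyshev and Mertens *)

Section Chebyshev.
Context {R : realType}.
Implicit Types (n m d k N : nat) (x y : R).
Local Notation Lambda := (@mangoldt R).

Lemma ln_le_subr1 x : 0 < x -> ln x <= x - 1.
Proof.
move=> x0; have := @le_ln1Dx R (x - 1).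
by rewrite addrCA subrr addr0 => -> //; lra.
Qed.

Lemma lnB_le x y : 0 < x -> 0 < y -> ln y - ln x <= (y - x) / x.
Proof.
move=> x0 y0; rewrite -ln_div ?posrE // (le_trans (ln_le_subr1 _)) ?divr_gt0 //.
by rewrite mulrBl divff ?gt_eqF.
Qed.

Lemma lnB_ge x y : 0 < x -> 0 < y -> (y - x) / y <= ln y - ln x.
Proof. by move=> x0 y0; have := lnB_le y0 x0; rewrite !mulrBl; lra. Qed.

Lemma divn_le_divr n d : (n %/ d)%:R <= n%:R / d%:R :> R.
Proof.
case: d => [|d]; first by rewrite divn0 mulr_ge0 ?invr_ge0 ?ler0n.
by rewrite ler_pdivlMr ?ltr0n // -natrM ler_nat leq_trunc_div.
Qed.

Lemma divr_lt_divn n d : (0 < d)%N -> n%:R / d%:R < (n %/ d)%:R + 1 :> R.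
Proof.
by move=> d0; rewrite ltr_pdivrMr ?ltr0n // natr1 -natrM ltr_nat ltn_ceil.
Qed.

Lemma sum_hyperbola_cond (A : nmodType) (f : nat -> nat -> A) N :
  \sum_(1 <= d < N.+1) \sum_(1 <= e < (N %/ d).+1) f d e =
  \sum_(1 <= d < N.+1) \sum_(1 <= e < N.+1 | (d * e <= N)%N) f d e.
Proof.
apply: eq_big_nat => d /andP[d0 _].
rewrite [RHS](@sum_nat_shorten _ _ _ (N %/ d).+1) ?ltnS ?leq_div //; last first.
  by move=> i /andP[ni _]; rewrite -ltnNge mulnC -ltn_divLR.
rewrite [RHS]big_nat_cond [LHS]big_nat_cond; apply: eq_bigl => e.
case: (boolP (1 <= e < _)%N) => //= /andP[_ eN].
by rewrite mulnC -leq_divRL // -ltnS eN.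
Qed.

Lemma sum_hyperbola_sym (A : nmodType) (f : nat -> nat -> A) N :
  \sum_(1 <= d < N.+1) \sum_(1 <= e < (N %/ d).+1) f d e =
  \sum_(1 <= e < N.+1) \sum_(1 <= d < (N %/ e).+1) f d e.
Proof.
rewrite sum_hyperbola_cond (sum_hyperbola_cond (fun e d => f d e)).
rewrite (eq_bigr _ (fun d _ => big_mkcond _ _)).
rewrite [RHS](eq_bigr _ (fun d _ => big_mkcond _ _)) exchange_big_nat /=.
by apply: eq_bigr => e _; apply: eq_bigr => d _; rewrite mulnC.
Qed.

Definition chebyshev_psi N : R := \sum_(1 <= n < N.+1) Lambda n.

Local Notation psi := chebyshev_psi.

Definition log_fact N : R := \sum_(1 <= n < N.+1) ln n%:R.

Lemma psiS N : psi N.+1 = psi N + Lambda N.+1.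
Proof. by rewrite /chebyshev_psi big_nat_recr. Qed.

Lemma psi0 : psi 0 = 0.
Proof. by rewrite /chebyshev_psi big_geq. Qed.

Lemma psiB m n : (m <= n)%N -> psi n - psi m = \sum_(m.+1 <= k < n.+1) Lambda k.
Proof. by move=> mn; rewrite /chebyshev_psi [X in X - _](@big_cat_nat _ _ _ m.+1) //= addrAC subrr add0r. Qed.

Lemma psi_homo : {homo psi : m n / (m <= n)%N >-> m <= n}.
Proof.
move=> m n mn; rewrite -subr_ge0 psiB //; apply: sumr_ge0 => *; exact: mangoldt_ge0.
Qed.

Lemma psi_ge0 n : 0 <= psi n.
Proof. by apply: sumr_ge0 => *; exact: mangoldt_ge0. Qed.

Lemma mangoldt_le_ln n : (0 < n)%N -> Lambda n <= ln n%:R.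
Proof.
move=> n0; rewrite -(sum_mangoldt_divisors n0) big_mkcond big_nat_recr //= dvdnn lerDr.
by apply: sumr_ge0 => i _; case: ifP => // _; exact: mangoldt_ge0.
Qed.

Lemma log_fact_psi N : log_fact N = \sum_(1 <= d < N.+1) psi (N %/ d).
Proof.
rewrite (sum_hyperbola_sym (fun _ e => Lambda e)).
rewrite -(dirichlet_hyperbola (fun d _ => Lambda d)).
by apply: eq_big_nat => n /andP[n0 _]; rewrite sum_mangoldt_divisors.
Qed.

(** The terms with d > N vanish. The free upper end [M] lets the sums for n and 2n be subtracted
    termwise in [psi_double]. *)
Lemma log_fact_mangoldt N M : (N <= M)%N ->
  log_fact N = \sum_(1 <= d < M.+1) Lambda d * (N %/ d)%:R.
Proof.
move=> NM; rewrite log_fact_psi (sum_hyperbola_sym (fun _ e => Lambda e)).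
rewrite [RHS](@big_cat_nat _ _ _ N.+1) //= [X in _ = _ + X]big1_seq ?addr0.
  by apply: eq_bigr => d _; rewrite big_const_nat subn1 /= iter_addr_0 mulr_natr.
move=> d; rewrite mem_index_iota => /andP[_ /andP[Nd _]].
by rewrite divn_small // mulr0.
Qed.

(** A weak form of Stirling's formula, by induction from 1/(x+1) <= ln(x+1) - ln x <= 1/x. *)
Lemma log_fact_bounds N : (0 < N)%N ->
  N%:R * ln N%:R - N%:R + 1 <= log_fact N <= N%:R * ln N%:R - N%:R + 1 + ln N%:R.
Proof.
case: N => // N _; elim: N => [|N IH].
  by rewrite /log_fact big_nat1 ln1; apply/andP; split; lra.
rewrite /log_fact big_nat_recr //= -/(log_fact _).
have N0 : 0 < N.+1%:R :> R by rewrite ltr0n.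
have N1 : 0 < N.+2%:R :> R by rewrite ltr0n.
have := lnB_le N0 N1; have := lnB_ge N0 N1.
have -> : N.+2%:R = N.+1%:R + 1 :> R by rewrite -natr1.
rewrite -natr1 in N1; set x := N.+1%:R in IH N0 N1 *.
rewrite [x + 1 - x]addrAC subrr add0r !div1r => h1 h2.
have h3 : x * (ln (x + 1) - ln x) <= 1.
  by rewrite (le_trans (ler_wpM2l (ltW N0) h2)) // divff // gt_eqF.
have h4 : 1 - (x+1)^-1 <= x * (ln (x + 1) - ln x).
  rewrite (le_trans _ (ler_wpM2l (ltW N0) h1)) // le_eqVlt; apply/orP; left.
  by apply/eqP; field; rewrite gt_eqF.
move: IH => /andP[I1 I2]; apply/andP; split; nra.
Qed.

(** Chebyshev's argument with the central binomial coefficient: its logarithm is the sum of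
    Lambda(d) times 2n/d rounded down minus twice n/d rounded down. These coefficients are
    nonnegative, and at least 1 for n < d <= 2n. *)
Lemma psi_double N : psi (2 * N) - psi N <= 4 * N%:R.
Proof.
case: N => [|N]; first by rewrite muln0 subrr mulr0.
set n := N.+1; have n0 : (0 < n)%N by [].
have H : psi (2 * n) - psi n <= log_fact (2 * n) - 2 * log_fact n.
  rewrite (log_fact_mangoldt (leqnn _)) (@log_fact_mangoldt n (2 * n)); last by lia.
  rewrite mulr_sumr -sumrB psiB; last by lia.
  rewrite [X in _ <= X](@big_cat_nat _ _ _ n.+1) //=; last by lia.
  have E d : (0 < d)%N -> (2 * (n %/ d) <= 2 * n %/ d)%N.
    by move=> d0; rewrite leq_divRL // -mulnA leq_mul2l leq_trunc_div.
  apply: ler_wpDl.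
    rewrite big_nat_cond; apply: sumr_ge0 => d /andP[/andP[d0 _] _].
    rewrite mulrCA -mulrBr mulr_ge0 ?mangoldt_ge0 // subr_ge0 -natrM ler_nat.
    exact: E.
  apply: ler_sum_nat => d /andP[nd dn]; rewrite (divn_small nd) mulr0 mulr0 subr0.
  rewrite ler_peMr ?mangoldt_ge0 // ler1n divn_gt0; lia.
apply: (le_trans H).
have /andP[_ h1] := @log_fact_bounds (2 * n) isT.
have /andP[h2 _] := log_fact_bounds n0.
have n0R : 0 < n%:R :> R by rewrite ltr0n.
move: h1 h2; rewrite natrM lnM ?posrE //.
have l2 : ln 2 <= 1 :> R by have := @ln_le_subr1 2; lra.
have l3 : ln n%:R <= n%:R - 1 :> R by apply: ln_le_subr1.
nra.
Qed.

(** Strong induction by halving [N] with [psi_double]; for odd [N] the one extra term is at most ln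
    N <= N - 1. *)
Lemma psi_le N : psi N <= 12 * N%:R.
Proof.
elim/ltn_ind: N => N IH.
have [N0|N0] := posnP N; first by rewrite N0 psi0 mulr0.
set m := (N %/ 2)%N.
have NE := divn_eq N 2; rewrite -/m in NE.
have mN : (m < N)%N by rewrite /m; lia.
have hm := IH _ mN; have hd := psi_double m.
have [E|E] : N = (2 * m)%N \/ N = (2 * m).+1 by lia.
  rewrite E natrM; have := ler0n R m; lra.
rewrite E psiS; have l1 : Lambda (2 * m).+1 <= (2 * m)%:R.
  apply: (le_trans (mangoldt_le_ln _)) => //.
  by have := @ln_le_subr1 (2 * m).+1%:R; rewrite ltr0n => /(_ isT); rewrite -natr1 addrK.
have m0 := ler0n R m; rewrite -natr1; move: l1; rewrite !natrM; lra.
Qed.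

(** Replacing [N %/ d] by N/d in [log_fact_mangoldt] changes each term by at most Lambda(d), hence
    the sum by at most psi(N) <= 12 N. *)
Lemma mertens N : (0 < N)%N ->
  ln N%:R - 1 <= \sum_(1 <= d < N.+1) Lambda d / d%:R <= ln N%:R + 12.
Proof.
move=> N0; have N0R : 0 < N%:R :> R by rewrite ltr0n.
have /andP[h1 h2] := log_fact_bounds N0.
have h3 : ln N%:R <= N%:R - 1 :> R by apply: ln_le_subr1.
have E := log_fact_mangoldt (leqnn N).
have h4 : log_fact N <= N%:R * \sum_(1 <= d < N.+1) Lambda d / d%:R.
  rewrite E mulr_sumr; apply: ler_sum_nat => d /andP[d0 _].
  by rewrite mulrCA ler_wpM2l ?mangoldt_ge0 // divn_le_divr.
have h5 : N%:R * (\sum_(1 <= d < N.+1) Lambda d / d%:R) <= log_fact N + psi N.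
  rewrite E mulr_sumr -big_split /=; apply: ler_sum_nat => d /andP[d0 _].
  rewrite mulrCA -{3}[Lambda d]mulr1 -mulrDr ler_wpM2l ?mangoldt_ge0 // ltW //.
  exact: divr_lt_divn.
have h6 := psi_le N.
apply/andP; split; rewrite -(ler_pM2l N0R); nra.
Qed.

End Chebyshev.

(** * Selberg's formula *)

Section Selberg.
Context {R : realType}.
Implicit Types (n m d k N : nat) (x y : R).
Local Notation Lambda := (@mangoldt R).
Local Notation psi := (@chebyshev_psi R).

Definition harmonic_sum n : R := \sum_(1 <= k < n.+1) k%:R^-1.

(** The constant is Euler's: [b] increases, [a] decreases, [b] stays below [a], and g is the
    supremum of [b]. *)
Lemma harmonic_sum_asymp : exists g : R, forall n, (0 < n)%N ->
  0 <= harmonic_sum n - ln n%:R - g <= n%:R^-1.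
Proof.
pose b n : R := harmonic_sum n - ln n.+1%:R.
pose a n : R := harmonic_sum n.+1 - ln n.+1%:R.
have HS n : harmonic_sum n.+1 = harmonic_sum n + n.+1%:R^-1 by rewrite /harmonic_sum big_nat_recr.
have pos n : 0 < n.+1%:R :> R by rewrite ltr0n.
have step n : n.+2%:R - n.+1%:R = 1 :> R by rewrite -[n.+2%:R]natr1 addrAC subrr add0r.
have bS n : b n <= b n.+1.
  have := lnB_le (pos n) (pos n.+1); rewrite step div1r /b HS; move: (n.+1%:R^-1) => t; lra.
have aS n : a n.+1 <= a n.
  have := lnB_ge (pos n) (pos n.+1); rewrite step div1r /a (HS n.+1); move: (n.+2%:R^-1) => t; lra.
have bhomo := homo_leq (@lexx _ R) (@le_trans _ R) bS.
have ahomo : {homo a : m n / (m <= n)%N >-> n <= m}.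
  by apply: (@homo_leq R a (fun x y => y <= x)) => // x y z h1 h2; exact: le_trans h2 h1.
have ba m n : b m <= a n.
  have ab k : b k <= a k by rewrite /a /b HS lerD2r lerDl invr_ge0 ltW.
  rewrite (le_trans (bhomo _ _ (leq_maxl m n))) // (le_trans (ab _)) //.
  exact/ahomo/leq_maxr.
exists (sup [set b n | n in [set: nat]]%classic) => -[//|n] _; apply/andP; split.
  rewrite subr_ge0; apply: ge_sup; first by exists (b 0), 0%N.
  by move=> _ [m _ <-]; exact: ba.
have : b n.+1 <= sup [set b n | n in [set: nat]]%classic.
  apply: ub_le_sup; last by exists n.+1.
  by exists (a 0) => _ [m _ <-]; exact: ba.
have := lnB_le (pos n) (pos n.+1); rewrite step div1r /b; move: (n.+1%:R^-1) => t; lra.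
Qed.

Lemma sum_invsqrt N : \sum_(1 <= d < N.+1) (Num.sqrt d%:R)^-1 <= 2 * Num.sqrt N%:R :> R.
Proof.
elim: N => [|N IH]; first by rewrite big_geq // sqrtr0 mulr0.
rewrite big_nat_recr //=; apply: (le_trans (lerD IH (lexx _))).
set u := Num.sqrt N%:R; set v := Num.sqrt N.+1%:R.
have u0 : 0 <= u by rewrite sqrtr_ge0.
have v0 : 0 < v by rewrite sqrtr_gt0 ltr0n.
have uE : u ^+ 2 = N%:R by rewrite sqr_sqrtr ?ler0n.
have vE : v ^+ 2 = N%:R + 1 by rewrite sqr_sqrtr ?ler0n // natr1.
rewrite -(ler_pM2r v0) mulrDl mulVf ?gt_eqF //; have := sqr_ge0 (v - u); nra.
Qed.

Lemma sum_sqr_ln_le N : (0 < N)%N ->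
  \sum_(1 <= d < N.+1) (ln (N%:R / d%:R)) ^+ 2 <= 32 * N%:R :> R.
Proof.
move=> N0; have N0R : 0 < N%:R :> R by rewrite ltr0n.
(* Write y = z^4 and use ln z <= z. The square root is chosen because the sum of 1 / sqrt d is of
   order sqrt N. *)
have H y : 1 <= y -> (ln y) ^+ 2 <= 16 * Num.sqrt y.
  move=> y1; set z := Num.sqrt (Num.sqrt y).
  have s1 : 1 <= Num.sqrt y by rewrite -[X in X <= _]sqrtr1 ler_wsqrtr.
  have z1 : 1 <= z by rewrite -[X in X <= _]sqrtr1 ler_wsqrtr.
  have z0 : 0 < z by apply: lt_le_trans z1.
  have sE : Num.sqrt y = z ^+ 2 by rewrite sqr_sqrtr // sqrtr_ge0.
  have yE : y = z ^+ 4.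
    by rewrite (_ : 4 = 2 * 2)%N // exprM -sE sqr_sqrtr // (le_trans _ y1).
  rewrite {1}yE lnXn // sE (_ : (ln z *+ 4) ^+ 2 = 16 * ln z ^+ 2); last by ring.
  have h := ln_le_subr1 z0; have h' := ln_ge0 z1.
  have : ln z ^+ 2 <= z ^+ 2 by rewrite ler_sqr ?nnegrE //; lra.
  by move=> ?; nra.
apply: (@le_trans _ _ (\sum_(1 <= d < N.+1) (16 * Num.sqrt N%:R) * (Num.sqrt d%:R)^-1)).
  apply: ler_sum_nat => d /andP[d0 dN]; rewrite (le_trans (H _ _)) //.
    by rewrite ler_pdivlMr ?ltr0n // mul1r ler_nat.
  by rewrite sqrtrM ?ler0n // sqrtrV ?ler0n // mulrA.
rewrite -mulr_sumr; have := sum_invsqrt N; have := sqrtr_ge0 (N%:R : R).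
have : Num.sqrt N%:R ^+ 2 = N%:R :> R by rewrite sqr_sqrtr ?ler0n.
nra.
Qed.

(** Partial summation as an induction: the step from N to N + 1 adds psi(N) (ln(N+1) - ln N) <= 12 N
    / N. *)
Lemma sum_mangoldt_ln_ratio N :
  \sum_(1 <= n < N.+1) Lambda n * (ln N%:R - ln n%:R) <= 12 * N%:R.
Proof.
elim: N => [|N IH]; first by rewrite big_geq // mulr0.
rewrite big_nat_recr //= subrr mulr0 addr0.
have [->|N0] := posnP N; first by rewrite big_geq // mulr_ge0.
have N0R : 0 < N%:R :> R by rewrite ltr0n.
have -> : \sum_(1 <= n < N.+1) Lambda n * (ln N.+1%:R - ln n%:R) =
  \sum_(1 <= n < N.+1) Lambda n * (ln N%:R - ln n%:R) + psi N * (ln N.+1%:R - ln N%:R).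
  by rewrite mulr_suml -big_split /=; apply: eq_bigr => n _; ring.
have := @lnB_le R N%:R N.+1%:R; rewrite !ltr0n -[N.+1%:R]natr1 => /(_ N0 isT).
rewrite [_ + 1 - _]addrAC subrr add0r div1r => h1.
have h2 := psi_le (R:=R) N; have h3 := psi_ge0 (R:=R) N.
have : psi N * (ln (N%:R + 1) - ln N%:R) <= (12 * N%:R) * N%:R^-1.
  apply: ler_pM => //; rewrite subr_ge0 ler_ln ?posrE //; lra.
rewrite mulfK ?gt_eqF //; lra.
Qed.

Lemma sum_ln_ratio_le N : (0 < N)%N ->
  \sum_(1 <= d < N.+1) ln (N%:R / d%:R) <= N%:R :> R.
Proof.
move=> N0; have N0R : 0 < N%:R :> R by rewrite ltr0n.
have -> : \sum_(1 <= d < N.+1) ln (N%:R / d%:R) = N%:R * ln N%:R - @log_fact R N.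
  have <- : \sum_(1 <= d < N.+1) ln N%:R = N%:R * ln N%:R :> R.
    by rewrite big_const_nat subn1 /= iter_addr_0 mulr_natl.
  by rewrite -sumrB; apply: eq_big_nat => d /andP[d0 _]; rewrite ln_div ?posrE ?ltr0n.
have /andP[h _] := log_fact_bounds (R:=R) N0; lra.
Qed.
End Selberg.

(** * The Tatuzawa-Iseki identity and Selberg's formula *)

Section SelbergFormula.
Context {R : realType}.
Implicit Types (n m d k N : nat) (x y : R).
Local Notation Lambda := (@mangoldt R).
Local Notation psi := (@chebyshev_psi R).

Lemma log_fact_divn N d : (0 < d <= N)%N ->
  `|log_fact (N %/ d) - (N%:R / d%:R * ln (N%:R / d%:R) - N%:R / d%:R)|
    <= 2 + ln (N%:R / d%:R) :> R.
Proof.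
move=> /andP[d0 dN]; set M := (N %/ d)%N; set y : R := N%:R / d%:R.
have M0 : (0 < M)%N by rewrite divn_gt0.
have M0R : 0 < M%:R :> R by rewrite ltr0n.
have M1R : 1 <= M%:R :> R by rewrite ler1n.
have My : M%:R <= y by exact: divn_le_divr.
have yM : y < M%:R + 1 by exact: divr_lt_divn.
have y0 : 0 < y by lra.
have lnM : ln M%:R <= ln y by rewrite ler_ln ?posrE.
have lnM0 : 0 <= ln M%:R :> R by exact: ln_nat_ge0.
have /andP[h1 h2] := log_fact_bounds (R:=R) M0.
have h3 := lnB_le M0R y0.
have h4 : M%:R * (ln y - ln M%:R) <= y - M%:R.
  by rewrite (le_trans (ler_wpM2l (ltW M0R) h3)) // mulrC divfK ?gt_eqF.
have h5 : 0 <= (y - M%:R) * ln y by rewrite mulr_ge0 //; lra.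
have h6 : (y - M%:R) * ln y <= 1 * ln y by apply: ler_wpM2r; lra.
have h7 : 0 <= M%:R * (ln y - ln M%:R) by rewrite mulr_ge0 //; lra.
rewrite ler_norml; apply/andP; split; lra.
Qed.

Lemma harmonic_sum_divn (g : R) N d :
  (forall n, (0 < n)%N -> 0 <= harmonic_sum n - ln n%:R - g <= n%:R^-1) ->
  (0 < d <= N)%N ->
  `|N%:R / d%:R * harmonic_sum (N %/ d)
     - (N%:R / d%:R * ln (N%:R / d%:R) + g * (N%:R / d%:R))| <= 2.
Proof.
move=> Hg /andP[d0 dN]; set M := (N %/ d)%N; set y : R := N%:R / d%:R.
have M0 : (0 < M)%N by rewrite divn_gt0.
have M0R : 0 < M%:R :> R by rewrite ltr0n.
have M1R : 1 <= M%:R :> R by rewrite ler1n.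
have My : M%:R <= y by exact: divn_le_divr.
have yM : y < M%:R + 1 by exact: divr_lt_divn.
have y0 : 0 < y by lra.
have lnM : ln M%:R <= ln y by rewrite ler_ln ?posrE.
have /andP[h1 h2] := Hg _ M0.
have h3 := lnB_le M0R y0.
have yV : y * M%:R^-1 <= 2 by rewrite ler_pdivrMr //; lra.
have h4 : y * (harmonic_sum M - ln M%:R - g) <= 2.
  exact: le_trans (ler_wpM2l (ltW y0) h2) yV.
have h5 : 0 <= y * (harmonic_sum M - ln M%:R - g) by rewrite mulr_ge0 // ltW.
have h6 : 0 <= y * (ln y - ln M%:R) by rewrite mulr_ge0 //; lra.
have h7 : y * (ln y - ln M%:R) <= 2.
  have h8 : (y - M%:R) / M%:R <= M%:R^-1.
    by apply: ler_piMl; [rewrite invr_ge0 ltW | lra].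
  exact: le_trans (ler_wpM2l (ltW y0) (le_trans h3 h8)) yV.
rewrite ler_norml; apply/andP; split; lra.
Qed.

(** Group the terms by k = d n and split ln(N/d) = ln(N/k) + ln(k/d). The Moebius sum leaves only k
    = 1 of the first part; the second part gives Lambda(k) by [sum_moebius_ln]. *)
Lemma tatuzawa_iseki (F : nat -> R) N : (0 < N)%N ->
  \sum_(1 <= d < N.+1) \sum_(1 <= n < (N %/ d).+1)
     moebius d * ln (N%:R / d%:R) * F (d * n)%N =
  F 1%N * ln N%:R + \sum_(1 <= k < N.+1) Lambda k * F k.
Proof.
move=> N0; have N0R : 0 < N%:R :> R by rewrite ltr0n.
rewrite -(dirichlet_hyperbola (fun d n => moebius d * ln (N%:R / d%:R) * F (d * n)%N)).
transitivity (\sum_(1 <= k < N.+1)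
   ((if k == 1%N then F 1%N * ln N%:R else 0) + Lambda k * F k)); last first.
  by rewrite big_split /= -big_mkcond big_nat1_eq /= ltnS N0.
apply: eq_big_nat => k /andP[k0 kN].
have k0R : 0 < k%:R :> R by rewrite ltr0n.
transitivity (\sum_(1 <= d < k.+1 | (d %| k)%N)
   (moebius d * (ln (N%:R / k%:R) * F k) + moebius d * ln (k %/ d)%:R * F k)).
  rewrite big_nat_cond [RHS]big_nat_cond; apply: eq_bigr => d /andP[/andP[d0 _] dk].
  have kE : (d * (k %/ d))%N = k by rewrite mulnC divnK.
  have kd0 : (0 < k %/ d)%N by rewrite divn_gt0 // dvdn_leq.
  have -> : N%:R / d%:R = (N%:R / k%:R) * (k %/ d)%:R :> R.
    have {1}<- : d%:R * (k %/ d)%:R = k%:R :> R by rewrite -natrM kE.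
    by field; rewrite !pnatr_eq0 -!lt0n d0 kd0.
  rewrite kE lnM ?posrE ?divr_gt0 ?ltr0n //; ring.
rewrite big_split /= -!mulr_suml sum_moebius_divisors // sum_moebius_ln //.
case: eqP => [->|_]; last by rewrite mul0r.
by rewrite divr1 mul1r mulrC.
Qed.

(** Selberg's generalised von Mangoldt function Lambda ln + Lambda * Lambda, supported on integers
    with at most two distinct prime factors. *)
Definition selberg_weight n : R :=
  Lambda n * ln n%:R + \sum_(1 <= d < n.+1 | (d %| n)%N) Lambda d * Lambda (n %/ d).

Definition selberg_sum N : R := \sum_(1 <= n < N.+1) selberg_weight n.

Lemma selberg_weight_ge0 n : 0 <= selberg_weight n.
Proof.
rewrite addr_ge0 ?mulr_ge0 ?mangoldt_ge0 ?ln_nat_ge0 //.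
by apply: sumr_ge0 => d _; rewrite mulr_ge0 ?mangoldt_ge0.
Qed.

Lemma selberg_sumE N : selberg_sum N =
  \sum_(1 <= n < N.+1) Lambda n * ln n%:R + \sum_(1 <= d < N.+1) Lambda d * psi (N %/ d).
Proof.
rewrite /selberg_sum big_split /=; congr (_ + _).
rewrite (dirichlet_hyperbola (fun d e => Lambda d * Lambda e)).
by apply: eq_bigr => d _; rewrite -mulr_sumr.
Qed.

(** [tatuzawa_iseki] is applied to psi(N/k) - N/k + g + 1. Its left side is O(N) by [sum_sqr_ln_le].
    Its right side is, up to O(N), the Selberg sum minus 2 N ln N: one N ln N comes from the term k
    = 1, the other from [mertens]. *)
Lemma selberg_formula : exists2 C : R, 0 <= C & forall N, (0 < N)%N ->
  `|selberg_sum N - 2 * N%:R * ln N%:R| <= C * N%:R.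
Proof.
have [g Hg] := @harmonic_sum_asymp R.
pose D := `|g + 1|; have D0 : 0 <= D by exact: normr_ge0.
(* 36 + D comes from [XB], 13 D from [q1], and 12 each from [q2] and [B2]. *)
exists (60 + 14 * D) => [|N N0]; first by lra.
have N0R : 0 < N%:R :> R by rewrite ltr0n.
(* The sums of F over the multiples of d are O(1 + ln (N / d)): the terms y ln y and
   g y of [log_fact] and of the harmonic sum, with y = N / d, cancel. *)
pose F k : R := psi (N %/ k) - N%:R / k%:R + (g + 1).
have := tatuzawa_iseki F N0; set X := (X in X = _) => XE.
have XB : `|X| <= (4 + D) * N%:R + 32 * N%:R.
  apply: (@le_trans _ _ (\sum_(1 <= d < N.+1)
     ((4 + D) * ln (N%:R / d%:R) + ln (N%:R / d%:R) ^+ 2))); last first.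
    rewrite big_split /= -mulr_sumr lerD ?sum_sqr_ln_le // ler_wpM2l ?sum_ln_ratio_le //; lra.
  apply: (le_trans (ler_norm_sum _ _ _)); apply: ler_sum_nat => d /andP[d0 dN].
  rewrite -mulr_sumr !normrM.
  set y : R := N%:R / d%:R.
  have y1 : 1 <= y by rewrite ler_pdivlMr ?ltr0n // mul1r ler_nat.
  have l0 : 0 <= ln y by exact: ln_ge0.
  have dN' : (0 < d <= N)%N by rewrite d0.
  have GE : \sum_(1 <= n < (N %/ d).+1) F (d * n)%N =
     log_fact (N %/ d) - y * harmonic_sum (N %/ d) + (g + 1) * (N %/ d)%:R.
    rewrite /F big_split sumrB /= big_const_nat subn1 /= iter_addr_0 mulr_natr.
    congr (_ - _ + _).
      by rewrite log_fact_psi; apply: eq_bigr => n _; rewrite divnMA.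
    by rewrite mulr_sumr; apply: eq_bigr => n _; rewrite natrM invfM mulrA.
  have h1 := log_fact_divn dN'; have h2 := harmonic_sum_divn Hg dN'.
  rewrite -/y in h1 h2.
  have h3 : `|(g + 1) * ((N %/ d)%:R - y)| <= D.
    rewrite normrM ler_piMr //.
    have := divn_le_divr (R:=R) N d; have := divr_lt_divn (R:=R) N d0; rewrite -/y.
    by move=> ? ?; rewrite ler_norml; apply/andP; split; lra.
  have GB : `|\sum_(1 <= n < (N %/ d).+1) F (d * n)%N| <= 4 + D + ln y.
    rewrite GE; move: h1 h2 h3; rewrite !ler_norml => /andP[? ?] /andP[? ?] /andP[? ?].
    apply/andP; split; lra.
  have mB := norm_moebius (R:=R) d.
  rewrite (ger0_norm l0).
  apply: (@le_trans _ _ (1 * ln y * (4 + D + ln y))); last by rewrite expr2; lra.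
  by rewrite ler_pM ?mulr_ge0 // ler_wpM2r.
have E1 : \sum_(1 <= k < N.+1) Lambda k * F k = \sum_(1 <= d < N.+1) Lambda d * psi (N %/ d)
    - N%:R * (\sum_(1 <= d < N.+1) Lambda d / d%:R) + (g + 1) * psi N.
  have -> : (g + 1) * psi N = \sum_(1 <= k < N.+1) (g + 1) * Lambda k by rewrite mulr_sumr.
  rewrite [N%:R * _]mulr_sumr -sumrB -big_split /=.
  by apply: eq_bigr => k _; rewrite /F; ring.
have E2 : \sum_(1 <= n < N.+1) Lambda n * (ln N%:R - ln n%:R) =
   psi N * ln N%:R - \sum_(1 <= n < N.+1) Lambda n * ln n%:R.
  by rewrite mulr_suml -sumrB; apply: eq_bigr => n _; ring.
have B2 := sum_mangoldt_ln_ratio (R:=R) N.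
have B2' : 0 <= \sum_(1 <= n < N.+1) Lambda n * (ln N%:R - ln n%:R).
  rewrite big_nat_cond; apply: sumr_ge0 => n /andP[/andP[n0 nN] _].
  by rewrite mulr_ge0 ?mangoldt_ge0 // subr_ge0 ler_ln ?posrE ?ltr0n // ler_nat.
have /andP[m1 m2] := mertens (R:=R) N0.
have p1 := psi_le (R:=R) N; have p0 := psi_ge0 (R:=R) N.
have l0 : 0 <= ln N%:R :> R by exact: ln_nat_ge0.
have l1 : ln N%:R <= N%:R :> R by have := ln_le_subr1 N0R; lra.
move: XE; rewrite E1 {1}/F divn1 divr1 => XE.
rewrite E2 in B2 B2'.
set Sm := \sum_(1 <= d < N.+1) Lambda d / d%:R in XE m1 m2.
have q1 : `|(g + 1) * (ln N%:R + psi N)| <= D * (13 * N%:R).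
  rewrite normrM ler_wpM2l // ger0_norm; lra.
have q2 : `|N%:R * (Sm - ln N%:R)| <= 12 * N%:R.
  rewrite normrM (ger0_norm (ltW N0R)) mulrC; apply: ler_wpM2r; first exact: ltW.
  by rewrite ler_norml; apply/andP; split; lra.
rewrite selberg_sumE; move: XB q1 q2; rewrite !ler_norml.
by move=> /andP[? ?] /andP[? ?] /andP[? ?]; apply/andP; split; lra.
Qed.

End SelbergFormula.

(** * Short intervals *)

Section ShortIntervals.
Context {R : realType}.
Implicit Types (n m d k N : nat).
Local Notation Lambda := (@mangoldt R).
Local Notation psi := (@chebyshev_psi R).

(** An inequality of Brun-Titchmarsh type: drop the nonnegative Lambda * Lambda part of Selberg's
    formula on (y, z] and divide by ln z. The condition z <= 2y + 1 is what rounding leaves of X <=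
    2x for the quotients by n. *)
Lemma psi_short_interval (eta : R) : 0 < eta -> exists2 Y : nat, (0 < Y)%N &
  forall y z, (Y <= y <= z)%N -> (z <= (2 * y).+1)%N ->
    psi z - psi y <= 2 * (z%:R - y%:R) + eta * z%:R.
Proof.
move=> eta0; have [C C0 HC] := @selberg_formula R.
(* 2C is the error of Selberg's formula at both ends, 24 and 2 the cost of replacing ln y by ln z on
   the two sides; ln z >= T turns their sum into eta. *)
pose T : R := (2 * C + 26) / eta.
have T0 : 0 <= T by rewrite divr_ge0 ?ltW //; lra.
exists (Num.trunc (expR T)).+1 => // y z /andP[Yy yz] zy.
have y0 : (0 < y)%N by lia.
have z0 : (0 < z)%N by lia.
have y0R : 0 < y%:R :> R by rewrite ltr0n.
have z0R : 0 < z%:R :> R by rewrite ltr0n.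
have yzR : y%:R <= z%:R :> R by rewrite ler_nat.
have z3y : z%:R <= 3 * y%:R :> R by rewrite -natrM ler_nat; lia.
have Tz : T <= ln z%:R.
  rewrite -[T]expRK ler_ln ?posrE ?expR_gt0 // (le_trans _ yzR) //.
  rewrite (le_trans (ltW (truncnS_gt _))) // ler_nat //.
have l0 : ln y%:R <= ln z%:R :> R by rewrite ler_ln ?posrE.
have lzy : ln z%:R - ln y%:R <= 2 :> R.
  rewrite (le_trans (lnB_le y0R z0R)) // ler_pdivrMr //; lra.
have lzy' : y%:R * (ln z%:R - ln y%:R) <= z%:R - y%:R :> R.
  by rewrite (le_trans (ler_wpM2l (ltW y0R) (lnB_le y0R z0R))) // mulrC divfK ?gt_eqF.
have p0 : 0 <= psi z - psi y by rewrite subr_ge0 psi_homo.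
have pz := psi_le (R:=R) z; have py := psi_ge0 (R:=R) y.
have Sd : (psi z - psi y) * ln y%:R <= selberg_sum z - selberg_sum y.
  rewrite psiB // mulr_suml /selberg_sum [X in _ <= X - _](@big_cat_nat _ _ _ y.+1) //=.
  rewrite [_ + _ - _]addrAC subrr add0r; apply: ler_sum_nat => n /andP[yn _].
  rewrite /selberg_weight ler_wpDr //.
    by apply: sumr_ge0 => d _; rewrite mulr_ge0 ?mangoldt_ge0.
  apply: ler_wpM2l; first exact: mangoldt_ge0.
  have n0R : 0 < n%:R :> R by rewrite ltr0n (leq_trans _ yn).
  by rewrite ler_ln ?posrE // ler_nat ltnW.
have := HC _ y0; have := HC _ z0; rewrite !ler_norml => /andP[_ hz] /andP[hy _].
have key : (psi z - psi y - 2 * (z%:R - y%:R)) * ln z%:R <= (2 * C + 26) * z%:R.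
  have : (psi z - psi y) * (ln z%:R - ln y%:R) <= (psi z - psi y) * 2 by rewrite ler_wpM2l.
  have : C * y%:R <= C * z%:R by rewrite ler_wpM2l.
  lra.
have etaT : eta * T = 2 * C + 26 by rewrite mulrC divfK ?gt_eqF.
rewrite -lerBlDl leNgt; apply/negP => bad.
have T1 : 0 < T by rewrite divr_gt0 //; lra.
have : (eta * z%:R) * T < (psi z - psi y - 2 * (z%:R - y%:R)) * ln z%:R.
  have e0 : 0 <= eta * z%:R by rewrite mulr_ge0 // ltW.
  by apply: (lt_le_trans _ (ler_wpM2l (le_trans e0 (ltW bad)) Tz)); rewrite ltr_pM2r.
nra.
Qed.

(** Counting by prime powers q gives the sum of Lambda(q) min(B, N/q). The q <= N/B contribute at
    most B psi(N/B) = O(N), the others N ln B + O(N) by [mertens]. *)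
Lemma sum_psi_divn B N : (0 < B <= N)%N ->
  `|\sum_(1 <= n < B.+1) psi (N %/ n) - N%:R * ln B%:R| <= 26 * N%:R.
Proof.
move=> /andP[B0 BN]; set M := (N %/ B)%N.
have M0 : (0 < M)%N by rewrite divn_gt0.
have MN : (M <= N)%N by exact: leq_div.
have N0 : (0 < N)%N by lia.
have N0R : 0 < N%:R :> R by rewrite ltr0n.
have M0R : 0 < M%:R :> R by rewrite ltr0n.
have B0R : 0 < B%:R :> R by rewrite ltr0n.
have QE : \sum_(1 <= n < B.+1) psi (N %/ n) =
    \sum_(1 <= q < N.+1) Lambda q * (minn B (N %/ q))%:R.
  transitivity (\sum_(1 <= n < N.+1 | (n <= B)%N) psi (N %/ n)).
    rewrite [RHS](@sum_nat_shorten _ _ _ B.+1) //; last by move=> i /andP[? _]; lia.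
    rewrite [LHS]big_nat_cond [RHS]big_nat_cond; apply: eq_bigl => i; lia.
  transitivity (\sum_(1 <= n < N.+1) \sum_(1 <= q < (N %/ n).+1)
      (if (n <= B)%N then Lambda q else 0)).
    rewrite big_mkcond; apply: eq_bigr => n _; case: ifP => // _.
    by rewrite big1.
  rewrite (sum_hyperbola_sym (fun n q => if (n <= B)%N then Lambda q else 0)).
  apply: eq_bigr => q _; rewrite -big_mkcond /=.
  rewrite (@sum_nat_shorten _ _ _ (minn B (N %/ q)).+1) ?ltnS ?geq_minr //; last first.
    by move=> i; lia.
  transitivity (\sum_(1 <= n < (minn B (N %/ q)).+1) Lambda q).
    rewrite [LHS]big_nat_cond [RHS]big_nat_cond; apply: eq_bigl => i; lia.
  by rewrite big_const_nat subn1 /= iter_addr_0 mulr_natr.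
have lBM : ln B%:R + ln M%:R <= ln N%:R :> R.
  by rewrite -lnM ?posrE // ler_ln ?posrE ?mulr_gt0 // -natrM ler_nat mulnC leq_trunc_div.
have lBM' : ln N%:R - ln M%:R <= ln B%:R + 1 :> R.
  have : ln N%:R <= ln (2 * (B%:R * M%:R)) :> R.
    rewrite ler_ln ?posrE ?mulr_gt0 // -!natrM ler_nat.
    have := ltn_ceil N B0; rewrite -/M; nia.
  have := @ln_le_subr1 R 2.
  rewrite !lnM ?posrE ?mulr_gt0 //; lra.
have /andP[mN1 mN2] := mertens (R:=R) N0.
have /andP[mM1 mM2] := mertens (R:=R) M0.
set SN := \sum_(1 <= d < N.+1) Lambda d / d%:R in mN1 mN2.
set SM := \sum_(1 <= d < M.+1) Lambda d / d%:R in mM1 mM2.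
have SE : SN - SM = \sum_(M.+1 <= q < N.+1) Lambda q / q%:R.
  by rewrite /SN (@big_cat_nat _ _ _ M.+1) //= addrAC subrr add0r.
have pN := psi_le (R:=R) N; have pM := psi_le (R:=R) M.
have MB : M%:R * B%:R <= N%:R :> R by rewrite -natrM ler_nat leq_trunc_div.
have U : \sum_(1 <= n < B.+1) psi (N %/ n) <= B%:R * psi M + N%:R * (SN - SM).
  rewrite QE SE [X in X <= _](@big_cat_nat _ _ _ M.+1) //= !mulr_sumr; apply: lerD.
    apply: ler_sum => q _; rewrite mulrC ler_wpM2r ?mangoldt_ge0 // ler_nat.
    exact: geq_minl.
  apply: ler_sum => q _; rewrite mulrCA ler_wpM2l ?mangoldt_ge0 //.
  by rewrite (le_trans _ (divn_le_divr _ _)) // ler_nat geq_minr.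
have L : N%:R * (SN - SM) - psi N <= \sum_(1 <= n < B.+1) psi (N %/ n).
  rewrite QE SE [X in _ <= X](@big_cat_nat _ _ _ M.+1) //= ler_wpDl //.
    by apply: sumr_ge0 => q _; rewrite mulr_ge0 ?mangoldt_ge0.
  have := psi_ge0 (R:=R) M => pM0.
  apply: (@le_trans _ _ (N%:R * \sum_(M.+1 <= q < N.+1) Lambda q / q%:R - (psi N - psi M))).
    lra.
  rewrite psiB // mulr_sumr -sumrB; apply: ler_sum_nat => q /andP[Mq qN].
  have q0 : (0 < q)%N by exact: leq_trans Mq.
  have -> : minn B (N %/ q) = (N %/ q)%N.
    apply/minn_idPr; rewrite -ltnS ltn_divLR // mulSn mulnC.
    by rewrite (leq_trans _ (leq_addl _ _)) // -ltn_divLR.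
  have := divr_lt_divn (R:=R) N q0.
  by rewrite mulrCA -{2}[Lambda q]mulr1 -mulrBr => h; rewrite ler_wpM2l ?mangoldt_ge0 //; lra.
have h1 : B%:R * psi M <= 12 * N%:R.
  by rewrite (le_trans (ler_wpM2l (ltW B0R) pM)) //; lra.
have h2 : N%:R * (SN - SM) <= N%:R * (ln B%:R + 14) by apply: ler_wpM2l; [exact: ltW | lra].
have h3 : N%:R * (ln B%:R - 13) <= N%:R * (SN - SM) by apply: ler_wpM2l; [exact: ltW | lra].
rewrite ler_norml; apply/andP; split; lra.
Qed.

Lemma sum_inv_nat A B : (0 < A <= B)%N ->
  `|\sum_(A.+1 <= n < B.+1) n%:R^-1 - (ln B%:R - ln A%:R)| <= 1 :> R.
Proof.
move=> /andP[A0 AB]; have B0 : (0 < B)%N by lia.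
have [g Hg] := @harmonic_sum_asymp R.
have /andP[a1 a2] := Hg _ A0; have /andP[b1 b2] := Hg _ B0.
have iA : A%:R^-1 <= 1 :> R by rewrite invf_le1 ?ltr0n // ler1n.
have iB : B%:R^-1 <= 1 :> R by rewrite invf_le1 ?ltr0n // ler1n.
have <- : harmonic_sum B - harmonic_sum A = \sum_(A.+1 <= n < B.+1) n%:R^-1 :> R.
  by rewrite /harmonic_sum [X in X - _](@big_cat_nat _ _ _ A.+1) //= addrAC subrr add0r.
rewrite ler_norml; apply/andP; split; lra.
Qed.

End ShortIntervals.

(** * Intervals without prime powers *)

Section PsiGap.
Context {R : realType}.
Implicit Types (n m d k N x X : nat).
Local Notation Lambda := (@mangoldt R).
Local Notation psi := (@chebyshev_psi R).

Definition chebyshev_gap x X n : R := psi (X %/ n) - psi (x %/ n).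

(** How far D(n), that is [chebyshev_gap x X n], stays below the asymptotic maximum 2 (X - x) / n.
    It can be slightly negative, see [psi_deficit_lb]. *)
Definition psi_deficit x X n : R := 2 * (X%:R - x%:R) / n%:R - chebyshev_gap x X n.

Lemma psi_gap_ge0 x X n : (x <= X)%N -> 0 <= chebyshev_gap x X n.
Proof. by move=> xX; rewrite subr_ge0 psi_homo // leq_div2r. Qed.

Lemma psi_gap_le x X n : (X <= 2 * x)%N -> chebyshev_gap x X n <= 24 * (x%:R / n%:R).
Proof.
move=> Xx; have h1 := psi_le (R:=R) (X %/ n); have h2 := psi_ge0 (R:=R) (x %/ n).
have h3 := divn_le_divr (R:=R) X n.
have h4 : X%:R / n%:R <= 2 * (x%:R / n%:R) :> R.
  by rewrite mulrA ler_wpM2r ?invr_ge0 // -natrM ler_nat.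
rewrite /chebyshev_gap; lra.
Qed.

Lemma psi_deficit_lb (eta : R) : 0 < eta -> exists2 Y : nat, (0 < Y)%N &
  forall x X n, (x <= X <= 2 * x)%N -> (0 < n)%N -> (n * Y <= x)%N ->
    - (eta * (x%:R / n%:R)) <= psi_deficit x X n.
Proof.
move=> eta0; have e4 : 0 < eta / 4 by rewrite divr_gt0.
have [Y Y0 HY] := psi_short_interval e4.
(* The second bound gives eta x / n >= 4, which absorbs the rounding of x/n and X/n. *)
exists (maxn Y (Num.trunc (4 / eta)).+1) => [|x X n /andP[xX Xx] n0 nY].
  by rewrite leq_max Y0.
have nYx : (Y <= x %/ n)%N.
  by rewrite leq_divRL // mulnC (leq_trans _ nY) // leq_mul2l leq_maxl orbT.
have le1 : (x %/ n <= X %/ n)%N by exact: leq_div2r.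
have le2 : (X %/ n <= (2 * (x %/ n)).+1)%N.
  rewrite -ltnS ltn_divLR // (leq_ltn_trans Xx) //.
  by have := ltn_ceil x n0; nia.
have := HY (x %/ n)%N (X %/ n)%N; rewrite nYx le1 => /(_ isT le2) H.
have h1 := divn_le_divr (R:=R) X n; have h2 := divr_lt_divn (R:=R) x n0.
have n0R : 0 < n%:R :> R by rewrite ltr0n.
have h4 : X%:R / n%:R <= 2 * (x%:R / n%:R) :> R.
  by rewrite mulrA ler_wpM2r ?invr_ge0 // -natrM ler_nat.
have h5 : 4 / eta <= x%:R / n%:R :> R.
  rewrite ler_pdivlMr // (le_trans (ler_wpM2r (ltW n0R) (ltW (truncnS_gt _)))) //.
  by rewrite -natrM ler_nat mulnC (leq_trans _ nY) // leq_mul2l leq_maxr orbT.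
have h6 : 4 <= eta * (x%:R / n%:R).
  by rewrite mulrC -ler_pdivrMr.
have h7 : eta / 4 * (X %/ n)%:R <= eta / 4 * (2 * (x%:R / n%:R)).
  by apply: ler_wpM2l; [exact: ltW | exact: le_trans h4].
rewrite /psi_deficit /chebyshev_gap.
have -> : 2 * (X%:R - x%:R) / n%:R = 2 * (X%:R / n%:R) - 2 * (x%:R / n%:R) :> R by ring.
lra.
Qed.

(** The difference of two instances of Selberg's formula; replacing ln M by ln N costs 2 M (ln M -
    ln N) <= 6 (M - N) <= 12 N. *)
Lemma selberg_sumB N M : (0 < N <= M)%N -> (M <= (2 * N).+1)%N ->
  forall C : R, 0 <= C -> (forall N, (0 < N)%N ->
  `|selberg_sum N - 2 * N%:R * ln N%:R| <= C * N%:R) ->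
  `|selberg_sum M - selberg_sum N - 2 * (M%:R - N%:R) * ln N%:R| <= (2 * C + 12) * N%:R + 2 * C * N%:R.
Proof.
move=> /andP[N0 NM] MN.
have M3N' : (M <= 3 * N)%N by lia.
move=> C C0 HC.
have M0 : (0 < M)%N by exact: leq_trans NM.
have N0R : 0 < N%:R :> R by rewrite ltr0n.
have M0R : 0 < M%:R :> R by rewrite ltr0n.
have NMR : N%:R <= M%:R :> R by rewrite ler_nat.
have M3N : M%:R <= 3 * N%:R :> R.
  by rewrite -natrM ler_nat.
have h1 := lnB_le N0R M0R.
have h0 : ln N%:R <= ln M%:R :> R by rewrite ler_ln ?posrE.
have h2 : M%:R * (ln M%:R - ln N%:R) <= 3 * N%:R * ((M%:R - N%:R) / N%:R) :> R.
  by apply: ler_pM => //; rewrite subr_ge0.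
have h3 : 3 * N%:R * ((M%:R - N%:R) / N%:R) = 3 * (M%:R - N%:R) :> R.
  by field; rewrite gt_eqF.
have h4 : 0 <= M%:R * (ln M%:R - ln N%:R) :> R by rewrite mulr_ge0 // ?subr_ge0 // ltW.
have h5 : C * M%:R <= C * (3 * N%:R) by exact: ler_wpM2l.
have := HC _ M0; have := HC _ N0; rewrite !ler_norml => /andP[? ?] /andP[? ?].
apply/andP; split; lra.
Qed.

(** [selberg_sumE] at both ends of (x/a, X/a]. Nested quotients merge by [divnMA], and the sum for x
    extends to b <= X/a because psi(0) = 0. *)
Lemma sum_mangoldt_gap x X a : (x <= X)%N -> (0 < a)%N ->
  selberg_sum (X %/ a) - selberg_sum (x %/ a) =
  \sum_((x %/ a).+1 <= n < (X %/ a).+1) Lambda n * ln n%:R +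
  \sum_(1 <= b < (X %/ a).+1) Lambda b * chebyshev_gap x X (a * b).
Proof.
move=> xX a0; have le := leq_div2r a xX.
rewrite !selberg_sumE [X in X + _ - _](@big_cat_nat _ _ _ (x %/ a).+1) //=.
have -> : \sum_(1 <= b < (X %/ a).+1) Lambda b * chebyshev_gap x X (a * b) =
  \sum_(1 <= d < (X %/ a).+1) Lambda d * psi (X %/ a %/ d) -
  \sum_(1 <= d < (x %/ a).+1) Lambda d * psi (x %/ a %/ d).
  have -> : \sum_(1 <= d < (x %/ a).+1) Lambda d * psi (x %/ a %/ d) =
     \sum_(1 <= d < (X %/ a).+1) Lambda d * psi (x %/ a %/ d).
    rewrite [RHS](@big_cat_nat _ _ _ (x %/ a).+1) //= [X in _ = _ + X]big1_seq ?addr0 //.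
    move=> d; rewrite mem_index_iota => /andP[_ /andP[xd _]].
    by rewrite divn_small // psi0 mulr0.
  by rewrite -sumrB; apply: eq_bigr => d _; rewrite /chebyshev_gap !divnMA mulrBr.
ring.
Qed.

(** As Lambda vanishes on (x, X], Selberg's formula gives the sum of Lambda(a) D(a) as 2 (X - x) ln
    x + O(x), which [mertens] compares with the sum of 2 (X - x) Lambda(a) / a. So the signed
    deficits sum to at most O(x). Passing to positive parts costs eta x / a for a <= x/Y by
    [psi_deficit_lb], and 24 x / a for larger a, where the sum of Lambda(a) / a is bounded. *)
Lemma sum_mangoldt_deficit (eta : R) : 0 < eta -> exists2 K : R, 0 <= K &
  forall x X, (0 < x)%N -> (x <= X <= 2 * x)%N ->
    (forall n, (x < n <= X)%N -> Lambda n = 0) ->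
    \sum_(1 <= a < x.+1) Lambda a * Num.max 0 (psi_deficit x X a) <= x%:R * (eta * ln x%:R + K).
Proof.
move=> eta0; have [Y Y0 HY] := psi_deficit_lb eta0.
have [C C0 HC] := @selberg_formula R.
have lY0 : 0 <= ln Y%:R :> R by exact: ln_nat_ge0.
exists (4 * C + 36 + 12 * eta + 24 * (ln Y%:R + 14) + 24 * (ln Y%:R + 14)).
  by have := ltW eta0; lra.
move=> x X x0 /andP[xX Xx] noL.
have x0R : 0 < x%:R :> R by rewrite ltr0n.
have xXR : x%:R <= X%:R :> R by rewrite ler_nat.
have XxR : X%:R <= 2 * x%:R :> R by rewrite -natrM ler_nat.
have xE : \sum_(1 <= a < x.+1) Lambda a * chebyshev_gap x X a = selberg_sum X - selberg_sum x.
  have := @sum_mangoldt_gap x X 1 xX isT; rewrite !divn1 => ->.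
  rewrite [X in _ = X + _]big1_seq ?add0r.
    rewrite [RHS](@big_cat_nat _ _ _ x.+1) //= [X in _ = _ + X]big1_seq ?addr0.
      by apply: eq_bigr => a _; rewrite mul1n.
    move=> a; rewrite mem_index_iota ltnS => /andP[_ h]; by rewrite noL ?mul0r.
  by move=> a; rewrite mem_index_iota ltnS => /andP[_ h]; rewrite noL ?mul0r.
have Sd : `|selberg_sum X - selberg_sum x - 2 * (X%:R - x%:R) * ln x%:R|
     <= (2 * C + 12) * x%:R + 2 * C * x%:R.
  by apply: selberg_sumB => //; [rewrite x0 | exact: leq_trans Xx _].
have /andP[m1 m2] := mertens (R:=R) x0.
set Sx := \sum_(1 <= d < x.+1) Lambda d / d%:R in m1 m2.
have E1 : \sum_(1 <= a < x.+1) Lambda a * psi_deficit x X a =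
   2 * (X%:R - x%:R) * Sx - \sum_(1 <= a < x.+1) Lambda a * chebyshev_gap x X a.
  rewrite mulr_sumr -sumrB; apply: eq_bigr => a _; rewrite /psi_deficit; ring.
have E2 : \sum_(1 <= a < x.+1) Lambda a * psi_deficit x X a <= (4 * C + 36) * x%:R.
  have : (X%:R - x%:R) * Sx <= (X%:R - x%:R) * (ln x%:R + 12).
    by apply: ler_wpM2l => //; lra.
  rewrite E1 xE; move: Sd; rewrite ler_norml => /andP[? _]; lra.
pose M := (x %/ Y)%N.
have N1 : \sum_(M.+1 <= a < x.+1) Lambda a / a%:R <= ln Y%:R + 14.
  have [M0|M0] := posnP M.
    rewrite M0 -/Sx (le_trans m2) //.
    have : x%:R <= Y%:R :> R by rewrite ler_nat ltnW // -[Y]mul1n -ltn_divLR // -/M M0.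
    by move=> h; have : ln x%:R <= ln Y%:R :> R; [rewrite ler_ln ?posrE ?ltr0n | lra].
  have /andP[n1 n2] := mertens (R:=R) M0.
  have Mx : (M <= x)%N by exact: leq_div.
  have <- : Sx - \sum_(1 <= d < M.+1) Lambda d / d%:R = \sum_(M.+1 <= a < x.+1) Lambda a / a%:R.
    by rewrite /Sx [X in X - _](@big_cat_nat _ _ _ M.+1) //= addrAC subrr add0r.
  have : ln x%:R <= ln (2 * (Y%:R * M%:R)) :> R.
    rewrite ler_ln ?posrE ?mulr_gt0 ?ltr0n // -!natrM ler_nat.
    rewrite (leq_trans (ltnW (ltn_ceil x Y0))) // -/M mulnC mulnCA leq_mul2l orbC.
    by rewrite mul2n -addnn -add1n leq_add2r M0.
  have : ln 2 <= 2 - 1 :> R by exact: ln_le_subr1.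
  rewrite !lnM ?posrE ?mulr_gt0 ?ltr0n //; lra.
have E3 : \sum_(1 <= a < x.+1) Lambda a * Num.max 0 (psi_deficit x X a) <=
   \sum_(1 <= a < x.+1) Lambda a * psi_deficit x X a + eta * x%:R * Sx +
   24 * x%:R * \sum_(M.+1 <= a < x.+1) Lambda a / a%:R.
  have -> : \sum_(M.+1 <= a < x.+1) Lambda a / a%:R =
     \sum_(1 <= a < x.+1) (if (M < a)%N then Lambda a / a%:R else 0).
    rewrite [RHS](@big_cat_nat _ _ _ M.+1) //= ?ltnS ?leq_div //.
    rewrite [X in _ = X + _]big1_seq ?add0r.
      by apply: eq_big_nat => a /andP[-> _].
    by move=> a; rewrite mem_index_iota => /andP[_ /andP[_ h]]; rewrite ltnNge -ltnS h.
  rewrite !mulr_sumr -!big_split /=; apply: ler_sum_nat => a /andP[a0 ax].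
  have a0R : 0 < a%:R :> R by rewrite ltr0n.
  have La := mangoldt_ge0 (R:=R) a.
  have dE : 0 <= x%:R / a%:R :> R by rewrite divr_ge0 // ltW.
  set E := psi_deficit x X a.
  have key : Num.max 0 E <= E + eta * (x%:R / a%:R) +
      24 * (if (M < a)%N then x%:R / a%:R else 0).
    have ee : 0 <= eta * (x%:R / a%:R) by rewrite mulr_ge0 // ltW.
    case: ltnP => [Ma|aM].
      have gE := psi_gap_le a Xx.
      have : 0 <= 2 * (X%:R - x%:R) / a%:R :> R by rewrite divr_ge0 ?mulr_ge0 ?subr_ge0.
      by move=> ?; rewrite ge_max; apply/andP; split; rewrite /E /psi_deficit; lra.
    have aY : (a * Y <= x)%N by rewrite -leq_divRL.
    have := HY x X a; rewrite xX Xx => /(_ isT a0 aY) h.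
    by rewrite ge_max; apply/andP; split; rewrite /E; lra.
  rewrite (le_trans (ler_wpM2l La key)) // le_eqVlt; apply/orP; left; apply/eqP.
  case: ifP => _; ring.
have h1 : eta * x%:R * Sx <= eta * x%:R * (ln x%:R + 12).
  by apply: ler_wpM2l => //; rewrite mulr_ge0 // ltW.
have h2 : 24 * x%:R * \sum_(M.+1 <= a < x.+1) Lambda a / a%:R <= 24 * x%:R * (ln Y%:R + 14).
  by apply: ler_wpM2l; [rewrite mulr_ge0 | exact: N1].
have h3 : 0 <= x%:R * (ln Y%:R + 14) :> R by rewrite mulr_ge0 //; lra.
lra.
Qed.

(** For each a, Selberg's formula on (x/a, X/a] bounds the sum of Lambda(b) D(a b) by the deficit at
    a times ln x, up to O(x/a); then sum over a with weight Lambda(a). *)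
Lemma sum_mangoldt2_gap : exists2 K : R, 0 <= K &
  forall x X, (0 < x)%N -> (x <= X <= 2 * x)%N ->
  \sum_(1 <= a < x.+1) \sum_(1 <= b < (x %/ a).+1) Lambda a * Lambda b * chebyshev_gap x X (a * b) <=
  ln x%:R * (\sum_(1 <= a < x.+1) Lambda a * Num.max 0 (psi_deficit x X a)) +
  K * x%:R * (ln x%:R + 12).
Proof.
have [C C0 HC] := @selberg_formula R.
exists (4 * C + 14) => [|x X x0 /andP[xX Xx]]; first by lra.
have x0R : 0 < x%:R :> R by rewrite ltr0n.
have xXR : x%:R <= X%:R :> R by rewrite ler_nat.
have /andP[_ m2] := mertens (R:=R) x0.
apply: (@le_trans _ _ (ln x%:R * (\sum_(1 <= a < x.+1) Lambda a * Num.max 0 (psi_deficit x X a)) +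
  (4 * C + 14) * x%:R * \sum_(1 <= a < x.+1) Lambda a / a%:R)); last first.
  by rewrite lerD2l; apply: ler_wpM2l => //; rewrite mulr_ge0 ?ltW //; lra.
rewrite !mulr_sumr -big_split /=; apply: ler_sum_nat => a /andP[a0 ax].
have La := mangoldt_ge0 (R:=R) a.
have a0R : 0 < a%:R :> R by rewrite ltr0n.
have y0 : (0 < x %/ a)%N by rewrite divn_gt0.
have le1 : (x %/ a <= X %/ a)%N by exact: leq_div2r.
have le2 : (X %/ a <= (2 * (x %/ a)).+1)%N.
  rewrite -ltnS ltn_divLR // (leq_ltn_trans Xx) //.
  by have := ltn_ceil x a0; nia.
set E := Num.max 0 _.
have -> : \sum_(1 <= b < (x %/ a).+1) Lambda a * Lambda b * chebyshev_gap x X (a * b) =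
  Lambda a * \sum_(1 <= b < (x %/ a).+1) Lambda b * chebyshev_gap x X (a * b).
  by rewrite mulr_sumr; apply: eq_bigr => b _; rewrite mulrA.
have -> : ln x%:R * (Lambda a * E) + (4 * C + 14) * x%:R * (Lambda a / a%:R) =
  Lambda a * (E * ln x%:R + (4 * C + 14) * (x%:R / a%:R)) by ring.
apply: ler_wpM2l => //.
set y := (x %/ a)%N in y0 le1 le2 *; set z := (X %/ a)%N in le1 le2.
have y0R : 0 < y%:R :> R by rewrite ltr0n.
have ly0 : 0 <= ln y%:R :> R by exact: ln_nat_ge0.
have lyx : ln y%:R <= ln x%:R :> R.
  by rewrite ler_ln ?posrE // ler_nat leq_div.
have h1 := sum_mangoldt_gap xX a0; rewrite -/y -/z in h1.
have h2 : chebyshev_gap x X a * ln y%:R <= \sum_(y.+1 <= n < z.+1) Lambda n * ln n%:R.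
  rewrite /chebyshev_gap psiB // mulr_suml; apply: ler_sum_nat => n /andP[yn _].
  apply: ler_wpM2l; first exact: mangoldt_ge0.
  have n0R : 0 < n%:R :> R by rewrite ltr0n (leq_trans _ yn).
  by rewrite ler_ln ?posrE // ler_nat ltnW.
have h3 : \sum_(1 <= b < y.+1) Lambda b * chebyshev_gap x X (a * b) <=
   \sum_(1 <= b < z.+1) Lambda b * chebyshev_gap x X (a * b).
  rewrite [leRHS](@big_cat_nat _ _ _ y.+1) //= lerDl; apply: sumr_ge0 => b _.
  by rewrite mulr_ge0 ?mangoldt_ge0 ?psi_gap_ge0.
have h4 : `|selberg_sum z - selberg_sum y - 2 * (z%:R - y%:R) * ln y%:R| <=
    (2 * C + 12) * y%:R + 2 * C * y%:R.
  by apply: selberg_sumB => //; rewrite y0.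
have yx : y%:R <= x%:R / a%:R :> R by exact: divn_le_divr.
have h5 : ln y%:R <= y%:R :> R by have := ln_le_subr1 y0R; lra.
have h6 : (2 * (z%:R - y%:R) - chebyshev_gap x X a) * ln y%:R <= (E + 2) * ln y%:R.
  apply: ler_wpM2r => //.
  have : psi_deficit x X a <= E by rewrite le_max lexx orbT.
  have q1 := divn_le_divr (R:=R) X a; have q2 := divr_lt_divn (R:=R) x a0.
  rewrite -/z in q1; rewrite -/y in q2.
  have qq : 2 * (X%:R - x%:R) / a%:R = 2 * (X%:R / a%:R) - 2 * (x%:R / a%:R) :> R by ring.
  rewrite /psi_deficit qq; lra.
have h7 : E * ln y%:R <= E * ln x%:R by apply: ler_wpM2l => //; rewrite le_max lexx.
have h8 : C * y%:R <= C * (x%:R / a%:R) by exact: ler_wpM2l.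
move: h4; rewrite ler_norml => /andP[_ h4].
lra.
Qed.

(** The minimum is bounded by the deficit on the part Lambda ln, and by D(n) on the part Lambda *
    Lambda; the two preceding estimates make both parts small. *)
Lemma selberg_weight_min_gap (eta : R) : 0 < eta -> exists x0 : nat,
  forall x X, (x0 <= x)%N -> (x <= X <= 2 * x)%N ->
    (forall n, (x < n <= X)%N -> Lambda n = 0) ->
    \sum_(1 <= n < x.+1) selberg_weight n * Num.min (chebyshev_gap x X n) (Num.max 0 (psi_deficit x X n))
      <= eta * x%:R * ln x%:R ^+ 2.
Proof.
move=> eta0; have e4 : 0 < eta / 4 by rewrite divr_gt0.
have [K1 K10 H1] := sum_mangoldt_deficit e4; have [K2 K20 H2] := sum_mangoldt2_gap.
(* Once ln x >= T, the lower-order terms (2 K1 + 13 K2) x ln x are at most half of the allowed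
   bound. *)
pose T : R := 1 + 2 / eta * (2 * K1 + 13 * K2).
have e2 : 0 <= 2 / eta by rewrite divr_ge0 // ltW.
have T1 : 1 <= T by rewrite lerDl mulr_ge0 //; lra.
exists (Num.trunc (expR T)).+1 => x X x0x xX noL.
have x0 : (0 < x)%N by exact: leq_trans x0x.
have x0R : 0 < x%:R :> R by rewrite ltr0n.
have Tx : T <= ln x%:R.
  rewrite -[T]expRK ler_ln ?posrE ?expR_gt0 // (le_trans (ltW (truncnS_gt _))) //.
  by rewrite ler_nat.
have h1 := H1 x X x0 xX noL; have h2 := H2 x X x0 xX.
set A := \sum_(1 <= a < x.+1) Lambda a * Num.max 0 (psi_deficit x X a) in h1 h2.
set B := \sum_(1 <= a < x.+1) \sum_(1 <= b < _) _ in h2.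
have xX' : (x <= X)%N by case/andP: xX.
apply: (@le_trans _ _ (ln x%:R * A + B)).
  rewrite /B -(dirichlet_hyperbola (fun a b => Lambda a * Lambda b * chebyshev_gap x X (a * b))).
  rewrite mulr_sumr -big_split /=; apply: ler_sum_nat => n /andP[n0 nx].
  rewrite mulrDl; apply: lerD.
    rewrite mulrAC [leRHS]mulrC; apply: ler_pM.
    - by rewrite mulr_ge0 ?mangoldt_ge0 // le_min psi_gap_ge0 //= le_max lexx.
    - exact: ln_nat_ge0.
    - by apply: ler_wpM2l; [exact: mangoldt_ge0 | rewrite ge_min lexx orbT].
    - by rewrite ler_ln ?posrE ?ltr0n // ler_nat.
  rewrite mulr_suml [leLHS]big_nat_cond [leRHS]big_nat_cond.
  apply: ler_sum => d /andP[/andP[d0 _] dn].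
  have -> : (d * (n %/ d))%N = n by rewrite mulnC divnK.
  apply: ler_wpM2l; first by rewrite mulr_ge0 ?mangoldt_ge0.
  by rewrite ge_min lexx.
set l : R := ln x%:R in Tx h1 h2 *.
have l1 : 1 <= l by lra.
have h3 : l * A <= l * (x%:R * (eta / 4 * l + K1)) by apply: ler_wpM2l => //; lra.
have h4 : K2 * x%:R * (l + 12) <= K2 * x%:R * (13 * l).
  by apply: ler_wpM2l; [rewrite mulr_ge0 // ltW | lra].
have h5 : 2 * K1 + 13 * K2 <= eta / 2 * l.
  have : eta / 2 * T <= eta / 2 * l by apply: ler_wpM2l => //; rewrite ltW // divr_gt0.
  have : eta / 2 * (2 / eta * (2 * K1 + 13 * K2)) = 2 * K1 + 13 * K2 by field; rewrite gt_eqF.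
  rewrite /T [_ * (1 + _)]mulrDr mulr1; have : 0 <= eta / 2 by rewrite ltW // divr_gt0.
  lra.
have xl : 0 <= x%:R * l by rewrite mulr_ge0 //; lra.
have : x%:R * l * (2 * K1 + 13 * K2) <= x%:R * l * (eta / 2 * l) by apply: ler_wpM2l.
lra.
Qed.

End PsiGap.

(** * Intervals without prime powers are short *)

Section PrimePowerGaps.
Context {R : realType}.
Implicit Types (n m d k N x X A : nat).
Local Notation Lambda := (@mangoldt R).
Local Notation psi := (@chebyshev_psi R).
Local Notation psi_gap := (@chebyshev_gap R).

Lemma ex_nat_ge (t : R) : exists2 n : nat, (0 < n)%N & t <= n%:R.
Proof. by exists (Num.trunc t).+1 => //; rewrite ltW // truncnS_gt. Qed.

Lemma divn_le_double z n m : (0 < n)%N -> (0 < m)%N -> (m <= 2 * n)%N -> (z %/ n <= (2 * (z %/ m)).+1)%N.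
Proof.
move=> n0 m0 m2n; rewrite -ltnS ltn_divLR //.
by have := ltn_ceil z m0; nia.
Qed.

(** For z = x and z = X, psi(z/n) - psi(z/m) is the weight of an interval of relative length at most
    rho - 1, small by [psi_short_interval]. Changing the factor n into m costs at most 24 (rho - 1)
    x. *)
Lemma psi_gap_variation (dl : R) : 0 < dl -> exists2 Y : nat, (0 < Y)%N &
  exists2 rho : R, 1 < rho <= 2 &
  forall x X n m, (x <= X <= 2 * x)%N -> (0 < n <= m)%N -> m%:R <= rho * n%:R ->
    (m * Y <= x)%N ->
    `|n%:R * psi_gap x X n - m%:R * psi_gap x X m| <= dl * x%:R.
Proof.
move=> dl0; pose eta := dl / 6; have eta0 : 0 < eta by rewrite divr_gt0.
have [Y1 Y10 HY] := psi_short_interval eta0.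
have [Y2 Y20 HY2] := ex_nat_ge (2 / eta).
exists (maxn Y1 Y2); first by rewrite leq_max Y10.
(* The total error is (28 r + 3 eta) x, and 28 r and 3 eta are each at most dl/2. *)
pose r := Num.min 1 (dl / 56).
have r0 : 0 < r by rewrite lt_min ltr01 divr_gt0.
have r1 : r <= 1 by rewrite ge_min lexx.
have r2 : r <= dl / 56 by rewrite ge_min lexx orbT.
exists (1 + r); first by apply/andP; split; lra.
move=> x X n m /andP[xX Xx] /andP[n0 nm] mrho mY.
have m0 : (0 < m)%N by exact: leq_trans nm.
have n0R : 0 < n%:R :> R by rewrite ltr0n.
have m0R : 0 < m%:R :> R by rewrite ltr0n.
have nmR : n%:R <= m%:R :> R by rewrite ler_nat.
have xXR : x%:R <= X%:R :> R by rewrite ler_nat.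
have XxR : X%:R <= 2 * x%:R :> R by rewrite -natrM ler_nat.
have m2n : (m <= 2 * n)%N.
  by rewrite -(ler_nat R) natrM (le_trans mrho) // ler_wpM2r //; lra.
have mY1 : (m * Y1 <= x)%N by rewrite (leq_trans _ mY) // leq_mul2l leq_maxl orbT.
have mY2 : (m * Y2 <= x)%N by rewrite (leq_trans _ mY) // leq_mul2l leq_maxr orbT.
pose u : R := x%:R / n%:R.
have u0 : 0 <= u by rewrite divr_ge0.
have un : n%:R * u = x%:R by rewrite mulrC divfK ?gt_eqF.
have two : 2 <= eta * u.
  rewrite mulrC -ler_pdivrMr // (le_trans HY2) // ler_pdivlMr // -natrM ler_nat mulnC.
  by rewrite (leq_trans _ mY2) // leq_mul2r nm orbT.
have step z : (x <= z <= 2 * x)%N ->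
    0 <= psi (z %/ n) - psi (z %/ m) <= (4 * r + 3 * eta) * u.
  move=> /andP[xz zx].
  have le1 : (z %/ m <= z %/ n)%N by exact: leq_div2l.
  rewrite subr_ge0 psi_homo //=.
  have zY : (Y1 <= z %/ m)%N by rewrite leq_divRL // mulnC (leq_trans mY1).
  have le2 : (z %/ n <= (2 * (z %/ m)).+1)%N.
    exact: divn_le_double.
  have := HY (z %/ m)%N (z %/ n)%N; rewrite zY le1 => /(_ isT le2) H.
  have h1 := divn_le_divr (R:=R) z n; have h2 := divr_lt_divn (R:=R) z m0.
  have z2 : z%:R <= 2 * x%:R :> R by rewrite -natrM ler_nat.
  have zu : z%:R / n%:R <= 2 * u by rewrite mulrA ler_wpM2r ?invr_ge0.
  have zd : z%:R / n%:R - z%:R / m%:R <= 2 * u * r.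
    have -> : z%:R / n%:R - z%:R / m%:R = z%:R / n%:R * ((m%:R - n%:R) / m%:R) :> R.
      by field; rewrite !gt_eqF.
    apply: ler_pM => //; rewrite ?divr_ge0 ?subr_ge0 //.
    rewrite ler_pdivrMr //; have : r * n%:R <= r * m%:R by rewrite ler_wpM2l // ltW.
    lra.
  have h3 : eta * (z %/ n)%:R <= eta * (2 * u).
    by apply: ler_wpM2l; [exact: ltW | exact: le_trans zu].
  lra.
have /andP[x1 x2] := step x (introT andP (conj (leqnn x) (leq_pmull x (isT : 0 < 2)%N))).
have /andP[X1 X2] := step X (introT andP (conj xX Xx)).
have V : `|psi_gap x X n - psi_gap x X m| <= (4 * r + 3 * eta) * u.
  rewrite ler_norml /chebyshev_gap; apply/andP; split; lra.
have gm := psi_gap_le (R:=R) m Xx; have gm0 : 0 <= psi_gap x X m by exact: psi_gap_ge0.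
have -> : n%:R * psi_gap x X n - m%:R * psi_gap x X m =
   n%:R * (psi_gap x X n - psi_gap x X m) - (m%:R - n%:R) * psi_gap x X m by ring.
rewrite (le_trans (ler_normB _ _)) // normrM (ger0_norm (ltW n0R)).
rewrite (@ger0_norm _ ((m%:R - n%:R) * _)); last by rewrite mulr_ge0 // subr_ge0.
have p1 : n%:R * `|psi_gap x X n - psi_gap x X m| <= n%:R * ((4 * r + 3 * eta) * u).
  by rewrite ler_wpM2l // ltW.
have p2 : (m%:R - n%:R) * psi_gap x X m <= (r * m%:R) * (24 * (x%:R / m%:R)).
  apply: ler_pM => //; rewrite ?subr_ge0 //.
  by have : r * n%:R <= r * m%:R; [rewrite ler_wpM2l // ltW | lra].
have p3 : (r * m%:R) * (24 * (x%:R / m%:R)) = 24 * r * x%:R by field; rewrite gt_eqF.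
have p4 : n%:R * ((4 * r + 3 * eta) * u) = (4 * r + 3 * eta) * x%:R by rewrite mulrCA un.
have : (28 * r + 3 * eta) * x%:R <= dl * x%:R.
  by apply: ler_wpM2r => //; rewrite /eta; lra.
lra.
Qed.

Lemma psi_gap_middle (dl : R) : 0 < dl -> exists2 k : nat, (0 < k)%N &
  exists A0 Y : nat, (0 < A0)%N /\ (0 < Y)%N /\
  forall x X A, (x <= X <= 2 * x)%N -> dl * x%:R <= X%:R - x%:R ->
    (A0 <= A)%N -> (k * A * Y <= x)%N -> (0 < x)%N ->
    exists2 n, (A < n <= k * A)%N &
      3 / 4 * (X%:R - x%:R) <= n%:R * psi_gap x X n <= 5 / 4 * (X%:R - x%:R).
Proof.
move=> dl0.
have [Y Y0 [rho /andP[rho1 rho2] HV]] := @psi_gap_variation (dl / 4) (divr_gt0 dl0 (ltr0n R 4)).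
(* This forces h ln k >= 5 h + 640 x for h = X - x, whereas each of the two cases at the end yields
   h ln k <= 5 h + 624 x. *)
pose T : R := 5 + 640 / dl.
have [k k0 Tk] := ex_nat_ge (expR T).
(* Beyond A0, n + 1 <= rho n, so [HV] applies to neighbours. *)
have [A0 A00 rA0] := ex_nat_ge (rho - 1)^-1.
exists k => //; exists A0, Y; split=> //; split=> //.
move=> x X A /andP[xX Xx] hdl A0A kAY x0.
have A1 : (0 < A)%N by exact: leq_trans A0A.
have x0R : 0 < x%:R :> R by rewrite ltr0n.
have k0R : 0 < k%:R :> R by rewrite ltr0n.
have A1R : 0 < A%:R :> R by rewrite ltr0n.
have xXR : x%:R <= X%:R :> R by rewrite ler_nat.
have XxR : X%:R <= 2 * x%:R :> R by rewrite -natrM ler_nat.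
have AkA : (A <= k * A)%N by rewrite leq_pmull.
have kAx : (k * A <= x)%N by rewrite (leq_trans _ kAY) // leq_pmulr.
have lk : T <= ln k%:R by rewrite -[T]expRK ler_ln ?posrE ?expR_gt0.
have lkA : ln (k * A)%:R - ln A%:R = ln k%:R :> R by rewrite natrM lnM ?posrE // addrK.
set h : R := X%:R - x%:R in hdl *.
have dx0 : 0 < dl * x%:R by rewrite mulr_gt0.
have h0 : 0 < h by lra.
pose SD := \sum_(A.+1 <= n < (k * A).+1) psi_gap x X n.
have SDE : `|SD - h * ln k%:R| <= 156 * x%:R.
  have cut z : \sum_(A.+1 <= n < (k * A).+1) psi (z %/ n) =
     \sum_(1 <= n < (k * A).+1) psi (z %/ n) - \sum_(1 <= n < A.+1) psi (z %/ n).
    by rewrite [X in _ = X - _](@big_cat_nat _ _ _ A.+1) //= addrAC subrr add0r.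
  have kA0 : (0 < k * A)%N by rewrite muln_gt0 k0.
  have := @sum_psi_divn R (k * A) X; have := @sum_psi_divn R (k * A) x.
  have := @sum_psi_divn R A X; have := @sum_psi_divn R A x.
  rewrite kA0 A1 kAx (leq_trans kAx xX) (leq_trans AkA kAx) (leq_trans AkA (leq_trans kAx xX)).
  move=> /(_ isT) a1 /(_ isT) a2 /(_ isT) a3 /(_ isT) a4.
  rewrite /SD sumrB !cut -lkA /h.
  move: a1 a2 a3 a4; rewrite !ler_norml => /andP[? ?] /andP[? ?] /andP[? ?] /andP[? ?].
  apply/andP; split; lra.
have kA0 : (0 < A <= k * A)%N by rewrite A1.
have := @sum_inv_nat R _ _ kA0; rewrite lkA ler_norml => /andP[i1 i2].
set SI := \sum_(_ <= _ < _) _ in i1 i2.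
have Th : h * T <= h * ln k%:R by rewrite ler_wpM2l // ltW.
have hT : 5 * h + 640 * x%:R <= h * T.
  have -> : h * T = 5 * h + 640 * (h / dl) by rewrite /T; ring.
  have : x%:R <= h / dl by rewrite ler_pdivlMr // [_ * dl]mulrC.
  lra.
move: SDE; rewrite ler_norml => /andP[s1 s2].
have rho0 : 0 < rho - 1 by lra.
have adj n : (A < n)%N -> (n.+1 <= k * A)%N ->
    `|n%:R * psi_gap x X n - n.+1%:R * psi_gap x X n.+1| <= dl / 4 * x%:R.
  move=> An nk; apply: HV => //; first by rewrite xX.
  - by rewrite leqnSn andbT (leq_trans _ An).
  - have : (rho - 1)^-1 <= n%:R.
      by rewrite (le_trans rA0) // ler_nat (leq_trans A0A) // ltnW.
    by rewrite -[_^-1]mul1r ler_pdivrMr // -natr1; lra.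
  - by rewrite (leq_trans _ kAY) // leq_mul2r nk orbT.
(* By [SDE] and [i1], [i2] the values n * psi_gap n have average close to h on (A, k A];
   by [adj] they cannot jump over the interval [3/4 h, 5/4 h]. *)
apply: contrapT => none.
have mid n : (A < n <= k * A)%N -> n%:R * psi_gap x X n < 3 / 4 * h \/ 5 / 4 * h < n%:R * psi_gap x X n.
  move=> An; case: (ltP (n%:R * psi_gap x X n) (3 / 4 * h)) => [|h1]; [by left | right].
  by rewrite ltNge; apply/negP => h2; apply: none; exists n => //; rewrite h1.
have [lowA|highA] : A.+1%:R * psi_gap x X A.+1 < 3 / 4 * h \/ ~ (A.+1%:R * psi_gap x X A.+1 < 3 / 4 * h).
  by case: (ltP (A.+1%:R * psi_gap x X A.+1) (3 / 4 * h)); [left | right].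
- have low j : (A + j.+1 <= k * A)%N -> (A + j.+1)%:R * psi_gap x X (A + j.+1) < 3 / 4 * h.
    elim: j => [|j IH] jk; first by rewrite addn1.
    have jk' : (A + j.+1 <= k * A)%N by apply: leq_trans jk; rewrite leq_add2l.
    have IH' := IH jk'.
    have Aj : (A < A + j.+1)%N by rewrite -addSnnS leq_addr.
    have := adj _ Aj; rewrite -addnS => /(_ jk); rewrite ler_norml => /andP[? ?].
    have := mid (A + j.+2)%N; rewrite jk -addSnnS leq_addr => /(_ isT); rewrite addSnnS.
    by case=> // ?; lra.
  have : SD <= 3 / 4 * h * SI.
    rewrite /SD mulr_sumr; apply: ler_sum_nat => n /andP[An nk].
    have nE : (A + (n - A).-1.+1 = n)%N by rewrite prednK ?subn_gt0 // subnKC // ltnW.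
    have := low (n - A).-1; rewrite nE => /(_ nk) lown.
    have n0R : 0 < n%:R :> R by rewrite ltr0n (leq_trans _ An).
    by rewrite ler_pdivlMr // mulrC ltW.
  have : 3 / 4 * h * SI <= 3 / 4 * h * (ln k%:R + 1).
    by rewrite ler_pM2l ?mulr_gt0 //; lra.
  lra.
- have high j : (A + j.+1 <= k * A)%N -> 5 / 4 * h < (A + j.+1)%:R * psi_gap x X (A + j.+1).
    elim: j => [|j IH] jk.
      by rewrite addn1; case: (mid A.+1) => //; rewrite leqnn -addn1.
    have jk' : (A + j.+1 <= k * A)%N by apply: leq_trans jk; rewrite leq_add2l.
    have IH' := IH jk'.
    have Aj : (A < A + j.+1)%N by rewrite -addSnnS leq_addr.
    have := adj _ Aj; rewrite -addnS => /(_ jk); rewrite ler_norml => /andP[? ?].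
    have := mid (A + j.+2)%N; rewrite jk -addSnnS leq_addr => /(_ isT); rewrite addSnnS.
    by case=> // ?; lra.
  have : 5 / 4 * h * SI <= SD.
    rewrite /SD mulr_sumr; apply: ler_sum_nat => n /andP[An nk].
    have nE : (A + (n - A).-1.+1 = n)%N by rewrite prednK ?subn_gt0 // subnKC // ltnW.
    have := high (n - A).-1; rewrite nE => /(_ nk) highn.
    have n0R : 0 < n%:R :> R by rewrite ltr0n (leq_trans _ An).
    by rewrite ler_pdivrMr // [leRHS]mulrC ltW.
  have : 5 / 4 * h * (ln k%:R - 1) <= 5 / 4 * h * SI.
    by rewrite ler_pM2l ?mulr_gt0 //; lra.
  lra.
Qed.

End PrimePowerGaps.

(** * Lower bound for the balanced weight, and the contradiction *)

Section PrimePowerGapsConclusion.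
Context {R : realType}.
Implicit Types (n m d k N x X A : nat).
Local Notation Lambda := (@mangoldt R).
Local Notation psi_gap := (@chebyshev_gap R).

(** The summand of [selberg_weight_min_gap]. Its second factor is of order (X - x) / n wherever n
    D(n) lies well inside the range from 0 to 2 (X - x). *)
Definition balanced_weight x X n : R :=
  selberg_weight n * Num.min (psi_gap x X n) (Num.max 0 (psi_deficit x X n)).

Lemma balanced_weight_ge0 x X n : (x <= X)%N -> 0 <= balanced_weight x X n.
Proof.
move=> xX; rewrite mulr_ge0 ?selberg_weight_ge0 // le_min psi_gap_ge0 //=.
by rewrite le_max lexx.
Qed.

(** Start at the n of [psi_gap_middle]. On (n, rho n] the value m D(m) moves by at most (X - x)/4,
    so both D(m) and the deficit stay above (X - x) / (2m); Selberg's formula supplies mass of order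
    n ln n there. *)
Lemma balanced_weight_block (dl : R) : 0 < dl -> exists2 c : R, 0 < c &
  exists K A0 Y : nat, (1 < K)%N /\ (0 < A0)%N /\ (0 < Y)%N /\
  forall x X A, (x <= X <= 2 * x)%N -> dl * x%:R <= X%:R - x%:R ->
    (A0 <= A)%N -> (K * A * Y <= x)%N -> (0 < x)%N ->
    c * x%:R * ln A%:R <= \sum_(A.+1 <= n < (K * A).+1) balanced_weight x X n.
Proof.
move=> dl0.
have [k k0 [A1 [Y1 [A10 [Y10 Hmid]]]]] := psi_gap_middle dl0.
have [Y2 Y20 [rho /andP[rho1 rho2] HV]] := @psi_gap_variation R (dl / 4) (divr_gt0 dl0 (ltr0n R 4)).
have [C C0 HC] := @selberg_formula R.
have rho0 : 0 < rho - 1 by lra.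
(* This makes (rho - 1) n >= 2, so that rounding rho n down to M keeps M - n >= (rho - 1) n / 2. *)
have [A2 A20 rA2] := @ex_nat_ge R (2 / (rho - 1)).
(* This keeps the error (4C + 12) n of [selberg_sumB] below half of the main term. *)
have [A3 A30 rA3] := @ex_nat_ge R (expR (2 * (4 * C + 12) / (rho - 1))).
exists (dl * (rho - 1) / 8); first by rewrite divr_gt0 // mulr_gt0.
exists (2 * k)%N, (maxn A1 (maxn A2 A3)), (maxn Y1 Y2).
split; first exact: leq_mul (leqnn 2) k0.
split; first by rewrite leq_max A10.
split; first by rewrite leq_max Y10.
move=> x X A /andP[xX Xx] hdl; rewrite !geq_max => /and3P[A1A A2A A3A] KAY x0.
have A0 : (0 < A)%N by exact: leq_trans A1A.
have kAY1 : (k * A * Y1 <= x)%N.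
  rewrite (leq_trans _ KAY) // -!mulnA mul2n -addnn (leq_trans _ (leq_addl _ _)) //.
  by rewrite !leq_mul2l leq_maxl !orbT.
have KAY2 : (2 * k * A * Y2 <= x)%N by rewrite (leq_trans _ KAY) // leq_mul2l leq_maxr orbT.
have xXx : (x <= X <= 2 * x)%N by rewrite xX.
have [n /andP[An nkA] /andP[m1 m2]] := Hmid x X A xXx hdl A1A kAY1 x0.
have n0 : (0 < n)%N by exact: leq_trans An.
have n0R : 0 < n%:R :> R by rewrite ltr0n.
have A0R : 0 < A%:R :> R by rewrite ltr0n.
have AnR : A%:R <= n%:R :> R by rewrite ler_nat ltnW.
have x0R : 0 < x%:R :> R by rewrite ltr0n.
set h : R := X%:R - x%:R in hdl m1 m2.
have rn0 : 0 <= rho * n%:R by rewrite mulr_ge0 //; lra.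
pose M := Num.trunc (rho * n%:R).
have Mle : M%:R <= rho * n%:R by rewrite truncn_le.
have Mlt : rho * n%:R < M%:R + 1 by have := truncnS_gt (rho * n%:R); rewrite -natr1.
have M2n : (M <= 2 * n)%N.
  by rewrite -(ler_nat R) natrM (le_trans Mle) // ler_wpM2r.
have n2 : 2 <= (rho - 1) * n%:R.
  rewrite mulrC -ler_pdivrMr // (le_trans rA2) // ler_nat (leq_trans A2A) // ltnW //.
have nM : (n <= M)%N by rewrite -(ler_nat R); lra.
have MK : (M <= 2 * k * A)%N by rewrite (leq_trans M2n) // -mulnA leq_mul2l.
apply: (@le_trans _ _ (\sum_(n.+1 <= m < M.+1) balanced_weight x X m)); last first.
  rewrite [leRHS](@big_cat_nat _ _ _ n.+1) //=; last first.
  - by rewrite ltnS (leq_trans nM).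
  - by rewrite ltnS ltnW.
  rewrite [X in _ + X](@big_cat_nat _ _ _ M.+1) //= ler_wpDl ?lerDl //.
    by apply: sumr_ge0 => i _; exact: balanced_weight_ge0.
  by apply: sumr_ge0 => i _; exact: balanced_weight_ge0.
apply: (@le_trans _ _ ((selberg_sum M - selberg_sum n) * (dl * x%:R / (4 * n%:R)))); last first.
  rewrite /selberg_sum [X in X - _](@big_cat_nat _ _ _ n.+1) //= addrAC subrr add0r mulr_suml.
  apply: ler_sum_nat => m /andP[nm mM]; apply: ler_wpM2l; first exact: selberg_weight_ge0.
  have m0R : 0 < m%:R :> R by rewrite ltr0n (leq_trans _ nm).
  have mMR : m%:R <= M%:R :> R by rewrite ler_nat.
  have := HV x X n m xXx; rewrite n0 (ltnW nm) => /(_ isT).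
  have -> : m%:R <= rho * n%:R by exact: le_trans Mle.
  have -> : (m * Y2 <= x)%N by rewrite (leq_trans _ KAY2) // leq_mul2r (leq_trans _ MK) ?orbT.
  move=> /(_ isT isT); rewrite ler_norml => /andP[v1 v2].
  have hm : dl * x%:R / (4 * n%:R) <= h / 2 / m%:R.
    rewrite ler_pdivrMr ?mulr_gt0 // mulrAC ler_pdivlMr //.
    have : dl * x%:R * m%:R <= h * (2 * n%:R).
      apply: ler_pM => //; first by rewrite mulr_ge0 // ltW.
      rewrite (le_trans mMR) // (le_trans Mle) // ler_wpM2r //.
    lra.
  rewrite (le_trans hm) // le_min le_max /psi_deficit -/h; apply/andP; split.
    by rewrite ler_pdivrMr // mulrC; lra.
  apply/orP; right; rewrite lerBrDl -lerBrDr -mulrBl ler_pdivlMr //.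
  by rewrite mulrC; lra.
have A3n : 2 * (4 * C + 12) <= (rho - 1) * ln n%:R.
  rewrite [leRHS]mulrC -ler_pdivrMr // -[leLHS]expRK ler_ln ?posrE ?expR_gt0 //.
  by rewrite (le_trans rA3) // ler_nat (leq_trans A3A) // ltnW.
have ln0 : 0 <= ln n%:R :> R by exact: ln_nat_ge0.
have lAn : ln A%:R <= ln n%:R :> R by rewrite ler_ln ?posrE.
have Sd : n%:R * ((rho - 1) / 2 * ln n%:R) <= selberg_sum M - selberg_sum n.
  have := @selberg_sumB R n M; rewrite n0 nM => /(_ isT (leqW M2n) C C0 HC).
  rewrite ler_norml => /andP[s1 _].
  have h1 : (rho - 1) * n%:R / 2 * ln n%:R <= (M%:R - n%:R) * ln n%:R.
    by apply: ler_wpM2r => //; lra.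
  have h2 : n%:R * (2 * (4 * C + 12)) <= n%:R * ((rho - 1) * ln n%:R).
    by apply: ler_wpM2l => //; exact: ltW.
  lra.
have q0 : 0 <= dl * x%:R / (4 * n%:R) by rewrite divr_ge0 ?mulr_ge0 // ltW.
apply: le_trans (ler_wpM2r q0 Sd).
have -> : n%:R * ((rho - 1) / 2 * ln n%:R) * (dl * x%:R / (4 * n%:R)) =
  dl * (rho - 1) / 8 * x%:R * ln n%:R by field; rewrite gt_eqF.
by apply: ler_wpM2l => //; rewrite !mulr_ge0 // ltW.
Qed.

(** The blocks (K^j, K^(j+1)] are disjoint and their lower bounds c j ln K form an arithmetic
    progression; the subtracted J0^2 accounts for the blocks before J0. *)
Lemma sum_blocks (f : nat -> R) (c : R) (K J0 : nat) :
  (1 < K)%N -> 0 <= c -> (forall n, 0 <= f n) ->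
  forall J, (forall j, (J0 <= j < J)%N ->
     c * ln (K ^ j)%:R <= \sum_((K ^ j).+1 <= n < (K * K ^ j).+1) f n) ->
  c * ln K%:R * (J%:R * (J%:R - 1) - J0%:R ^+ 2) / 2 <= \sum_(1 <= n < (K ^ J).+1) f n.
Proof.
move=> K1 c0 f0; have K0 : (0 < K)%N by exact: ltnW.
have lK : 0 <= c * ln K%:R by rewrite mulr_ge0 // ln_nat_ge0.
have s0 J : 0 <= \sum_(1 <= n < (K ^ J).+1) f n by apply: sumr_ge0.
elim=> [|J IH] HJ.
  apply: le_trans (s0 _).
  have : 0 <= c * ln K%:R * J0%:R ^+ 2 by rewrite mulr_ge0 // sqr_ge0.
  by rewrite mul0r sub0r mulrN mulNr; lra.
have {}IH := IH (fun j h => HJ j (introT andP (conj (proj1 (andP h)) (leqW (proj2 (andP h)))))).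
have [JJ0|J0J] := ltnP J J0.
  apply: le_trans (s0 _).
  have : J.+1%:R * (J.+1%:R - 1) <= J0%:R ^+ 2 :> R.
    rewrite expr2; apply: ler_pM; rewrite ?subr_ge0 ?ler1n ?ler_nat //.
    by rewrite (@le_trans _ _ J.+1%:R) ?ler_nat // gerBl.
  move=> h; have : c * ln K%:R * (J.+1%:R * (J.+1%:R - 1) - J0%:R ^+ 2) <= 0.
    by rewrite mulr_ge0_le0 // subr_le0.
  lra.
have := HJ J; rewrite J0J ltnSn => /(_ isT) h.
rewrite (@big_cat_nat _ _ _ (K ^ J).+1) //= ?ltnS ?leq_exp2l // expnS.
rewrite natrX lnXn ?ltr0n // -[ln _ *+ _]mulr_natl in h.
apply: le_trans (lerD IH h); rewrite -natr1; lra.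
Qed.

(** Without prime powers in (x, X], the total [balanced_weight] would be at most eta x (ln x)^2,
    while the disjoint blocks at powers of K give a fixed multiple of x (ln x)^2. *)
Theorem prime_power_gap (eps : R) : 0 < eps -> exists x0 : nat, forall x, (x0 <= x)%N ->
  exists2 n : nat, (x < n)%N /\ n%:R <= (1 + eps) * x%:R & Lambda n != 0.
Proof.
move=> eps0; pose e := Num.min eps 1.
have e0 : 0 < e by rewrite lt_min eps0 ltr01.
have e1 : e <= 1 by rewrite ge_min lexx orbT.
have ee : e <= eps by rewrite ge_min lexx.
have dl0 : 0 < e / 2 by rewrite divr_gt0.
have [c c0 [K [A0 [Y [K1 [A00 [Y0 Hb]]]]]]] := balanced_weight_block dl0.
have K0R : 0 < K%:R :> R by rewrite ltr0n ltnW.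
have lK : 0 < ln K%:R :> R by rewrite ln_gt0 // ltr1n.
(* With ln x <= 2 J ln K the upper bound becomes c x ln K J^2 / 8, half of the lower bound c x ln K
   J^2 / 4. *)
pose eta : R := c / (32 * ln K%:R).
have eta0 : 0 < eta by rewrite divr_gt0 // mulr_gt0.
have [x1 Hx1] := selberg_weight_min_gap eta0.
have [x2 x20 Hx2] := @ex_nat_ge R (2 / e).
(* J >= J1 turns ln x <= (J + 1) ln K + ln Y into ln x <= 2 J ln K. *)
have [J1 J10 HJ1] := @ex_nat_ge R (1 + ln Y%:R / ln K%:R).
(* J >= 2 A0 and J >= 4 give J (J - 1) - A0^2 >= J^2 / 2. *)
pose J2 := maxn J1 (maxn (2 * A0) 4).
exists (maxn x1 (maxn x2 (Y * K ^ J2))) => x; rewrite !geq_max => /and3P[xx1 xx2 xx3].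
have x0 : (0 < x)%N by exact: leq_trans xx2.
have x0R : 0 < x%:R :> R by rewrite ltr0n.
have ex2 : 2 <= e * x%:R.
  rewrite mulrC -ler_pdivrMr // (le_trans Hx2) // ler_nat //.
have ex1 : e * x%:R <= 1 * x%:R by apply: ler_wpM2r.
have eex : e * x%:R <= eps * x%:R by apply: ler_wpM2r.
pose X := Num.trunc ((1 + e) * x%:R).
have X0 : 0 <= (1 + e) * x%:R by rewrite mulr_ge0 //; lra.
have Xle : X%:R <= (1 + e) * x%:R by rewrite truncn_le.
have Xlt : (1 + e) * x%:R < X%:R + 1 by have := truncnS_gt ((1 + e) * x%:R); rewrite -natr1.
have xX : (x <= X <= 2 * x)%N.
  by rewrite -(ler_nat R) -[(X <= _)%N](ler_nat R) natrM; apply/andP; split; lra.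
have hdl : e / 2 * x%:R <= X%:R - x%:R by lra.
apply: contrapT => none.
have noL n : (x < n <= X)%N -> Lambda n = 0.
  move=> /andP[xn nX]; apply/eqP; apply: contrapT => /negP L; apply: none; exists n => //.
  split=> //; have : n%:R <= X%:R :> R by rewrite ler_nat.
  lra.
have up := Hx1 x X xx1 xX noL.
pose q := (x %/ Y)%N.
have q0 : (0 < q)%N.
  rewrite divn_gt0 // (leq_trans _ xx3) // leq_pmulr // expn_gt0 ltnW //.
pose J := trunc_log K q.
have KJ : (K ^ J <= q)%N by exact: trunc_logP.
have qK : (q < K ^ J.+1)%N by exact: trunc_log_ltn.
have J2J : (J2 <= J)%N.
  by rewrite trunc_log_max // leq_divRL // mulnC.
have KJY : (K ^ J * Y <= x)%N by rewrite -leq_divRL.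
have KJx : (K ^ J <= x)%N by rewrite (leq_trans _ KJY) // leq_pmulr.
have lx : ln x%:R <= 2 * J%:R * ln K%:R :> R.
  have xlt : (x <= K ^ J.+1 * Y)%N.
    by rewrite (leq_trans (ltnW (ltn_ceil x Y0))) // leq_mul2r qK orbT.
  have : ln x%:R <= ln (K ^ J.+1 * Y)%:R :> R.
    by rewrite ler_ln ?posrE ?ltr0n ?muln_gt0 ?expn_gt0 ?(ltnW K1) // ler_nat.
  rewrite natrM natrX lnM ?posrE ?exprn_gt0 ?ltr0n ?(ltnW K1) // lnXn // -[ln _ *+ _]mulr_natl -natr1.
  have : J1%:R <= J%:R :> R by rewrite ler_nat (leq_trans _ J2J) // leq_maxl.
  move=> h1; have : (1 + ln Y%:R / ln K%:R) * ln K%:R <= J%:R * ln K%:R :> R.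
    by apply: ler_wpM2r; [exact: ltW | exact: le_trans h1].
  rewrite mulrDl divfK ?gt_eqF //; lra.
have x_le_X : (x <= X)%N by case/andP: xX.
have low : c * x%:R * ln K%:R * (J%:R * (J%:R - 1) - A0%:R ^+ 2) / 2 <=
    \sum_(1 <= n < (K ^ J).+1) balanced_weight x X n.
  apply: sum_blocks => //; first by rewrite mulr_ge0 // ltW.
    by move=> n; exact: balanced_weight_ge0.
  (* The block starts at A = K^j, and A0 <= j < K^j. *)
  move=> j /andP[A0j jJ]; apply: Hb => //.
    by rewrite (leq_trans A0j) // ltnW // ltn_expl.
  by rewrite -expnS (leq_trans _ KJY) // leq_mul2r leq_exp2l // jJ orbT.
have low2 : \sum_(1 <= n < (K ^ J).+1) balanced_weight x X n <=
    \sum_(1 <= n < x.+1) balanced_weight x X n.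
  rewrite [leRHS](@big_cat_nat _ _ _ (K ^ J).+1) //= lerDl.
  by apply: sumr_ge0 => n _; exact: balanced_weight_ge0.
have J4 : 4 <= J%:R :> R.
  by rewrite ler_nat (leq_trans _ J2J) // !leq_max leqnn !orbT.
have JA : 2 * A0%:R <= J%:R :> R.
  by rewrite -natrM ler_nat (leq_trans _ J2J) // !leq_max leqnn !orbT.
have JJ : J%:R ^+ 2 / 4 <= (J%:R * (J%:R - 1) - A0%:R ^+ 2) / 2 :> R.
  have : (2 * A0%:R) ^+ 2 <= J%:R ^+ 2 :> R by rewrite ler_sqr ?nnegrE ?mulr_ge0.
  have : 4 * J%:R <= J%:R * J%:R :> R by rewrite ler_wpM2r.
  rewrite exprMn !expr2; lra.
have l0 : 0 <= ln x%:R :> R by exact: ln_nat_ge0.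
have lx2 : ln x%:R ^+ 2 <= (2 * J%:R * ln K%:R) ^+ 2 :> R.
  by rewrite ler_sqr // nnegrE; exact: le_trans lx.
have cx0 : 0 < c * x%:R * ln K%:R by rewrite !mulr_gt0.
have h1 : c * x%:R * ln K%:R * (J%:R ^+ 2 / 4) <= eta * x%:R * ln x%:R ^+ 2.
  apply: le_trans (le_trans (le_trans low low2) up).
  by rewrite -[X in _ <= X]mulrA ler_wpM2l // ltW.
have h2 : eta * x%:R * ln x%:R ^+ 2 <= eta * x%:R * (2 * J%:R * ln K%:R) ^+ 2.
  by apply: ler_wpM2l => //; rewrite mulr_ge0 // ltW.
have h3 : eta * x%:R * (2 * J%:R * ln K%:R) ^+ 2 = c * x%:R * ln K%:R * (J%:R ^+ 2 / 8).
  by rewrite /eta; field; rewrite gt_eqF.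
have : 0 < c * x%:R * ln K%:R * J%:R ^+ 2.
  by rewrite mulr_gt0 // exprn_gt0 // (lt_le_trans _ J4).
lra.
Qed.

End PrimePowerGapsConclusion.

(** * Bose-Chowla sets *)

Section FrobeniusFixed.
Context {L : finFieldType} (q : nat).
Context (q_gt1 : (1 < q)%N) (q_pchar : [pchar L]%N.-nat q).

(** The subfield with q elements once [#|L| = q ^ r], as the fixed points of the q-power map; being
    a predicate on [L], it can serve in [polyOver]. *)
Definition frob_fixed : {pred L} := fun x => x ^+ q == x.

Lemma frob_fixedE x : (x \in frob_fixed) = (x ^+ q == x).
Proof. by []. Qed.

Lemma frob_fixed_subring : subring_closed frob_fixed.
Proof.
have q0 : (0 < q)%N by exact: ltnW.
have B (x y : L) : (x - y) ^+ q = x ^+ q - y ^+ q.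
  by rewrite -[x in RHS](subrK y) [in RHS]exprDn_pchar // addrK.
split.
- by rewrite frob_fixedE expr1n.
- by move=> x y; rewrite !frob_fixedE B => /eqP -> /eqP ->.
- by move=> x y; rewrite !frob_fixedE exprMn => /eqP -> /eqP ->.
Qed.
HB.instance Definition _ := GRing.isSubringClosed.Build L frob_fixed frob_fixed_subring.

Lemma frob_fixedV (x : L) : x \in frob_fixed -> x^-1 \in frob_fixed.
Proof. by rewrite !frob_fixedE exprVn => /eqP ->. Qed.

Lemma card_frob_fixed_le : (#|frob_fixed| <= q)%N.
Proof.
have sz : size ('X^q - 'X : {poly L}) = q.+1.
  by rewrite size_polyDl size_polyXn // size_polyN size_polyX.
have p0 : ('X^q - 'X : {poly L}) != 0 by rewrite -size_poly_eq0 sz.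
rewrite cardE -ltnS -sz; apply: max_poly_roots => //; last exact: enum_uniq.
by apply/allP => x; rewrite mem_enum frob_fixedE => /eqP h; rewrite rootE !hornerE h subrr.
Qed.

Context (r : nat) (theta : L).
Context (cardL : #|L| = (q ^ r)%N) (r0 : (0 < r)%N).
Context (theta_prim : (q ^ r).-1.-primitive_root theta).

Lemma prim_root_generates (x : L) : x != 0 -> exists i : 'I_(q ^ r).-1, x = theta ^+ i.
Proof.
move=> x0; have x1 : x ^+ (q ^ r).-1 = 1.
  apply: (mulfI x0); rewrite mulr1 -exprS prednK ?expn_gt0 ?(ltnW q_gt1) //.
  by rewrite -cardL expf_card.
by have [i ->] := prim_rootP theta_prim x1; exists i.
Qed.

Lemma root_generator_size (P : {poly L}) :
  P \is a polyOver frob_fixed -> P != 0 -> root P theta -> (r < size P)%N.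
Proof.
move=> PK P0 rP; rewrite ltnNge; apply/negP => sP.
pose d := (size P).-1; have sPd : size P = d.+1 by rewrite prednK // size_poly_gt0.
have lc0 : lead_coef P != 0 by rewrite lead_coef_eq0.
have /polyOverP PKc := PK.
have rep x : exists2 Q : {poly L}, Q \is a polyOver frob_fixed /\ (size Q <= d)%N & Q.[theta] = x.
  have [->|/prim_root_generates [i ->]] := eqVneq x 0.
    by exists 0; rewrite ?horner0 // rpred0 size_poly0.
  case: (posnP d) => [d0|d0].
    have := size1_polyC (eq_leq (etrans sPd (congr1 S d0))) => PC.
    by move: rP P0; rewrite PC rootC => /eqP ->; rewrite polyC0 eqxx.
  elim: (i : nat) => [|n [Q [QK sQ] Qn]].
    exists 1; last by rewrite hornerE.
    by rewrite rpred1 size_poly1.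
  have /polyOverP QKc := QK.
  (* Multiplication by ['X] followed by reduction modulo [P]; the quotient of coefficients stays
     fixed by Frobenius. *)
  exists ('X * Q - (Q`_d.-1 / lead_coef P) *: P); last first.
    by rewrite !hornerE Qn (rootP rP) mulr0 subr0 exprS.
  split.
    rewrite rpredB ?rpredM ?polyOverX ?polyOverZ ?rpredM ?QKc ?frob_fixedV //; exact: PKc.
  apply/leq_sizeP => j dj; rewrite coefB coefXM coefZ.
  have [->|dj'] := eqVneq j d.
    by rewrite (gtn_eqF d0) /lead_coef -/d divfK ?subrr.
  have dj1 : (d < j)%N by rewrite ltn_neqAle eq_sym dj' dj.
  have Pj : P`_j = 0 by rewrite nth_default ?sPd.
  have Qj : Q`_j.-1 = 0 by rewrite nth_default // (leq_trans sQ) //; case: (j) dj1.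
  by rewrite (gtn_eqF (leq_ltn_trans (leq0n d) dj1)) Pj Qj mulr0 subr0.
(* By [rep], the at most q ^ d polynomials of degree < d with coefficients fixed by
   Frobenius take all q ^ r values at theta. *)
pose ev (f : {ffun 'I_d -> L}) := \sum_i f i * theta ^+ i.
have sub : [set: L] \subset ev @: [set f in ffun_on frob_fixed].
  apply/fintype.subsetP => x _; have [Q [/polyOverP QK sQ] <-] := rep x.
  apply/imsetP; exists [ffun i : 'I_d => Q`_i].
    by rewrite inE; apply/ffun_onP => i; rewrite ffunE.
  by rewrite (horner_coef_wide _ sQ); apply: eq_bigr => i _; rewrite ffunE.
have := leq_trans (subset_leq_card sub) (leq_imset_card _ _).
rewrite cardsT cardL cardsE card_ffun_on card_ord => h.
have : (q ^ r <= q ^ d)%N.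
  apply: leq_trans h _; have [->|d0] := posnP d; first by rewrite !expn0.
  by rewrite leq_exp2r // card_frob_fixed_le.
by rewrite leq_exp2l // leqNgt -sPd sP.
Qed.

(** Zero and the powers of theta^e with e = (q^r - 1)/(q - 1) are q distinct fixed points. *)
Lemma card_frob_fixed_ge : (q <= #|frob_fixed|)%N.
Proof.
have q0 : (0 < q)%N by exact: ltnW.
pose e := (\sum_(i < r) q ^ i)%N.
have eE : ((q ^ r).-1 = q.-1 * e)%N by rewrite predn_exp.
have e0 : (0 < e)%N by rewrite /e; case: (r) r0 => // r' _; rewrite big_ord_recl expn0.
pose s := 0 :: [seq theta ^+ (e * i) | i <- iota 0 q.-1].
have th0 : theta != 0.
  apply/eqP => th0; have /eqP := prim_expr_order theta_prim.
  by rewrite th0 expr0n gtn_eqF ?(prim_order_gt0 theta_prim) // eq_sym oner_eq0.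
have us : uniq s.
  rewrite /= map_inj_in_uniq ?iota_uniq ?andbT.
    by apply/negP => /mapP[i _ /esym/eqP]; rewrite expf_eq0 (negbTE th0) andbF.
  move=> i j; rewrite !mem_iota !add0n /= => iq jq /eqP.
  by rewrite (eq_prim_root_expr theta_prim) eE !modn_small ?(mulnC e) ?ltn_pmul2r // eqn_pmul2r // => /eqP.
have <- : size s = q by rewrite /= size_map size_iota prednK.
rewrite cardE; apply: uniq_leq_size us _ => x.
rewrite mem_enum inE frob_fixedE => /orP[/eqP->|/mapP[i _ ->]].
  by rewrite expr0n gtn_eqF.
rewrite -exprM -{1}(prednK q0) mulnS exprD.
have -> : (e * i * q.-1 = q.-1 * e * i)%N by rewrite mulnC mulnA.
by rewrite -eE [theta ^+ (_.-1 * i)]exprM (prim_expr_order theta_prim) expr1n mulr1.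
Qed.

End FrobeniusFixed.

Lemma ex_primitive_root_finField (L : finFieldType) : exists theta : L, #|L|.-1.-primitive_root theta.
Proof.
have c0 : (0 < #|L|.-1)%N by rewrite -ltnS prednK ?finNzRing_gt1 // ltnW ?finNzRing_gt1.
have /hasP[theta _ H] : has #|L|.-1.-primitive_root (enum (predC1 (0 : L))).
  apply: has_prim_root => //.
  - apply/allP => x; rewrite mem_enum inE => x0; apply/unity_rootP.
    by apply: (mulfI x0); rewrite mulr1 -exprS prednK ?expf_card // ltnW ?finNzRing_gt1.
  - exact: enum_uniq.
  - by rewrite -cardE cardC1.
by exists theta.
Qed.

Lemma bose_chowla q r :
  (exists p k, prime p /\ q = (p ^ k.+1)%N) -> (0 < r)%N ->
  exists2 f : 'I_q -> nat, (forall i, 0 < f i <= q ^ r)%N &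
    forall A B : {set 'I_q}, #|A| = r -> #|B| = r ->
      (\sum_(i in A) f i = \sum_(i in B) f i)%N -> A = B.
Proof.
move=> [p [k [pp qE]]] r0.
have q1 : (1 < q)%N by rewrite qE (ltn_exp2l 0) ?prime_gt1.
(* For r = 1 the generator lies in the subfield itself and some [theta - b i] would be 0, without a
   logarithm; the weights i + 1 serve there. *)
have [r1|r1] := leqP r 1.
  have rE : r = 1%N by apply/eqP; rewrite eqn_leq r1.
  exists (fun i : 'I_q => i.+1) => [i|A B]; first by rewrite rE expn1 ltn_ord.
  rewrite rE => /eqP/cards1P[a ->] /eqP/cards1P[b ->].
  by rewrite !big_set1 => -[] /val_inj ->.
have kr0 : (0 < k.+1 * r)%N by rewrite muln_gt0.
have [L Lp cardL'] := pPrimePowerField pp kr0.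
have cardL : #|L| = (q ^ r)%N by rewrite cardL' qE expnM.
have qL : [pchar L]%N.-nat q by rewrite qE pnatX pnatE // Lp.
have [theta] := ex_primitive_root_finField L; rewrite cardL => th.
have := card_frob_fixed_ge q1 r0 th; set K := frob_fixed q => Kq.
pose b (i : 'I_q) := nth 0 (enum K) i.
have bs (i : 'I_q) : (i < size (enum K))%N by rewrite -cardE (leq_trans _ Kq).
have bK i : b i \in K by rewrite -(mem_enum K) mem_nth.
have b_inj : injective b.
  by move=> i j /eqP; rewrite nth_uniq ?enum_uniq // => /eqP /val_inj.
have size_root := root_generator_size q1 qL cardL th.
have nz i : theta - b i != 0.
  apply/eqP => h; have := size_root ('X - (b i)%:P).
  rewrite size_XsubC ltnNge r1 polyXsubC_eq0 rootE !hornerE h eqxx.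
  by rewrite polyOverXsubC // => /(_ (bK i) isT isT).
have [lg lgE] := fin_all_exists (fun i => prim_root_generates q1 cardL th (nz i)).
(* The successor makes weights positive; it shifts the sums over [A] and [B] by the same r. *)
exists (fun i => (lg i).+1) => [i|A B cA cB].
  by rewrite /= (leq_trans (ltn_ord _)) // leq_pred.
pose P (S : {set 'I_q}) := \prod_(i <- enum S) ('X - (b i)%:P).
have PK S : P S \is a polyOver K.
  by apply: rpred_prod => i _; rewrite polyOverXsubC.
have Pth S : (P S).[theta] = theta ^+ (\sum_(i in S) lg i).
  rewrite horner_prod big_enum /= -prodrXr; apply: eq_bigr => i _.
  by rewrite !hornerE lgE.
have Psz (S : {set 'I_q}) : #|S| = r -> size (P S) = r.+1 by rewrite size_prod_XsubC -cardE => ->.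
have Proot (S : {set 'I_q}) i : root (P S) (b i) = (i \in S).
  by rewrite /P -(big_map b xpredT (fun x => 'X - x%:P)) root_prod_XsubC mem_map ?mem_enum.
rewrite !(eq_bigr _ (fun i _ => esym (addn1 _))) !big_split /= !sum1_card cA cB => /addIn E.
(* Both polynomials are monic of degree r and agree at [theta], so a nonzero difference would have
   size at most r and root [theta], against [size_root]. *)
have PE : P A = P B.
  apply/eqP; rewrite -subr_eq0; apply/negPn/negP => D0.
  have := size_root (P A - P B); rewrite rpredB // D0 => /(_ isT isT).
  rewrite rootE hornerD hornerN !Pth E subrr eqxx => /(_ isT); rewrite ltnNge => /negP[].
  have mo S : P S \is monic by exact: monic_prod_XsubC.
  apply/leq_sizeP => j rj; rewrite coefB.
  have [->|jr] := eqVneq j r.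
    have cr (S : {set 'I_q}) : #|S| = r -> (P S)`_r = 1.
      by move=> cS; have /monicP := mo S; rewrite /lead_coef Psz.
    by rewrite !cr // subrr.
  by rewrite !nth_default ?subr0 // Psz // ltn_neqAle eq_sym jr.
by apply/setP => i; rewrite -!Proot PE.
Qed.

(** * Upper and lower bounds for [omega0] *)

Lemma omega0_le_prime_power q r (H : hypergraph) :
  (exists p k, prime p /\ q = (p ^ k.+1)%N) -> (0 < r)%N -> uniform r H ->
  (#|vertices H| <= q)%N -> (omega0 H <= #|vertices H| * q ^ r)%N.
Proof.
move=> qpp r0 uH Vq.
have [f f_bound f_inj] := bose_chowla qpp r0.
pose g (v : vertices H) := widen_ord Vq (enum_rank v).
have g_inj : injective g.
  by move=> u v /(congr1 val) /= h; apply: enum_rank_inj; exact: val_inj.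
pose lam : {ffun vertices H -> nat} := [ffun v => f (g v)].
have lamE (E : {set vertices H}) : (\sum_(v in E) lam v = \sum_(i in g @: E) f i)%N.
  rewrite big_imset /=; last by move=> ? ? _ _; exact: g_inj.
  by apply: eq_bigr => v _; rewrite ffunE.
have disc : edge_discriminator lam.
  split=> [E EH|E E' EH E'H neq].
    have : (0 < #|E|)%N by rewrite (uH E EH).
    move=> /card_gt0P[v vE]; rewrite (bigD1 v) //= ffunE ltn_addr //.
    by have /andP[] := f_bound (g v).
  rewrite !lamE => /f_inj h; apply: neq; apply: (imset_inj g_inj); apply: h.
    by rewrite card_imset // uH.
  by rewrite card_imset // uH.
have [_ /(_ lam disc) le] := omega0_min (uniform_set0 r0 uH).
apply: (leq_trans le); rewrite /weight -sum_nat_const.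
by apply: leq_sum => v _; rewrite ffunE; have /andP[] := f_bound (g v).
Qed.

Lemma binomial_ge_exp n r : (r <= n)%N -> ((n - r) ^ r <= 'C(n, r) * r`!)%N.
Proof.
move=> rn; rewrite bin_ffact; elim: r rn => [|r IH] rn; first by rewrite ffactn0.
rewrite ffactnSr expnSr leq_mul //; last by rewrite leq_sub2l.
apply: leq_trans (IH (ltnW rn)).
by case: (posnP r) => [->|r0]; [rewrite !expn0 | rewrite leq_exp2r // leq_sub2l].
Qed.

Lemma omega0_complete_ge r m : (0 < r)%N -> (0 < m)%N ->
  (m * 'C((m %/ 2), r) <= 2 * r * omega0 (complete_hypergraph r m))%N.
Proof.
move=> r0 m0; set H := complete_hypergraph r m.
have [[lam [pos inj] wE] _] := omega0_min (uniform_set0 r0 (@complete_uniform r m)).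
set W := omega0 _ in wE *.
pose S : {set 'I_m} := [set v | lam v * m <= 2 * W]%N.
have cS : (m %/ 2 <= #|S|)%N.
  have h : (#|~: S| * (2 * W).+1 <= m * W)%N.
    apply: (@leq_trans (\sum_(v in ~: S) m * lam v)).
      by rewrite -sum_nat_const; apply: leq_sum => v; rewrite !inE -ltnNge [(m * _)%N]mulnC.
    rewrite -big_distrr leq_mul2l -wE /weight /=.
    by rewrite [leqRHS](bigID (mem (~: S))) leq_addr orbT.
  have := cardsC S; rewrite card_ord => mE.
  rewrite leqNgt; apply/negP => lt.
  have h2 : (m <= 2 * #|~: S|)%N by lia.
  have : (m * (2 * W).+1 <= 2 * (m * W))%N.
    by rewrite (leq_trans (leq_mul h2 (leqnn _))) // -mulnA leq_mul2l h.
  nia.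
pose D := [set E : {set 'I_m} | (E \subset S) && (#|E| == r)].
have cD : #|D| = 'C(#|S|, r) by exact: cards_draws.
pose N := (2 * r * W %/ m)%N.
have sumN (E : {set 'I_m}) : E \in D -> (\sum_(v in E) lam v < N.+1)%N.
  rewrite inE => /andP[/fintype.subsetP ES /eqP cE]; rewrite ltnS leq_divRL // big_distrl /=.
  rewrite -mulnA mulnCA -cE -sum_nat_const; apply: leq_sum => v vE.
  by have := ES v vE; rewrite inE.
have DH (E : {set 'I_m}) : E \in D -> E \in hyperedges H.
  by rewrite !inE => /andP[].
pose F (E : {set 'I_m}) : 'I_N.+1 := inord (\sum_(v in E) lam v).
have F_inj : {in D &, injective F}.
  move=> E E' ED E'D /(congr1 val); rewrite /= !inordK ?sumN // => e.
  by apply: contrapT => neq; apply: (inj E E' (DH _ ED) (DH _ E'D) neq).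
(* Edge weights are positive, so 0 is not taken and N values remain instead of N + 1. *)
have : (#|D| <= #|[set~ (ord0 : 'I_N.+1)]|)%N.
  rewrite -(card_in_imset F_inj); apply: subset_leq_card.
  apply/fintype.subsetP => _ /imsetP[E ED ->]; rewrite !inE; apply/eqP => /(congr1 val).
  by rewrite /= inordK ?sumN // => e; have := pos E (DH _ ED); rewrite e.
rewrite cardsC1 card_ord /= cD => le.
have : ('C((m %/ 2), r) <= N)%N by rewrite (leq_trans _ le) // leq_bin2l.
by rewrite leq_divRL // mulnC.
Qed.

(** * Asymptotics *)

(** The convex function (1 + e)^r lies below its chord over [0, 1]; the induction uses e^2 <= e. *)
Lemma expr1D_le (R : realType) (e : R) r : 0 <= e <= 1 ->
  (1 + e) ^+ r <= 1 + (2 ^+ r - 1) * e.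
Proof.
move=> /andP[e0 e1]; elim: r => [|r IH]; first by rewrite !expr0 subrr mul0r addr0.
rewrite exprSr (le_trans (ler_wpM2r _ IH)) //; first by rewrite addr_ge0.
have t1 : 1 <= 2 ^+ r :> R by rewrite exprn_ege1 // ler1n.
rewrite exprS; set t := 2 ^+ r in t1 *.
have : (t - 1) * e * e <= (t - 1) * e * 1 by rewrite ler_wpM2l // mulr_ge0 // subr_ge0.
lra.
Qed.

Lemma omega0_complete_ge_exp r m : (0 < r)%N -> (8 * r + 8 <= m)%N ->
  (m ^ r.+1 <= 4 ^ r * (2 * r * r`!) * omega0 (complete_hypergraph r m))%N.
Proof.
move=> r0 rm.
have m0 : (0 < m)%N by lia.
have h1 := omega0_complete_ge r0 m0.
have h2 : ((m %/ 2 - r) ^ r <= 'C(m %/ 2, r) * r`!)%N by apply: binomial_ge_exp; lia.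
have h3 : (m <= 4 * (m %/ 2 - r))%N by lia.
rewrite expnS.
apply: (@leq_trans (m * (4 ^ r * ('C(m %/ 2, r) * r`!)))%N).
  by rewrite leq_mul2l (leq_trans _ (leq_mul (leqnn _) h2)) ?orbT // -expnMn leq_exp2r.
have -> : (m * (4 ^ r * ('C(m %/ 2, r) * r`!)) = 4 ^ r * r`! * (m * 'C(m %/ 2, r)))%N by ring.
apply: (leq_trans (leq_mul (leqnn _) h1)).
by rewrite leq_eqVlt; apply/orP; left; apply/eqP; ring.
Qed.

(** Allows [ex_minn] to pick the least prime power from m on. *)
Lemma ex_mangoldt_neq0 (R : realType) m : exists n, (m <= n)%N && (mangoldt n != 0 :> R).
Proof.
have [p mp pp] := prime_above m; exists p; rewrite (ltnW mp) /=.
have := mangoldt_pfactor (R:=R) 0 pp; rewrite expn1 => ->.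
by rewrite gt_eqF // ln_gt0 // ltr1n prime_gt1.
Qed.

Local Open Scope classical_set_scope.
Local Open Scope ring_scope.

Theorem proposition1p1 (R : realType) (r : nat) (hr : (0 < r)%N) :
  (exists2 err : nat -> R,
     err =o_\oo (fun m : nat => m%:R ^+ r.+1 : R) &
     forall (m : nat) (H : hypergraph),
       uniform r H -> #|vertices H| = m ->
       (omega0 H)%:R <= m%:R ^+ r.+1 + err m) /\
  (exists2 c : R, 0 < c &
     \forall m \near \oo,
       c * m%:R ^+ r.+1 <= (omega0 (complete_hypergraph r m))%:R).
Proof.
split.
- pose q m := ex_minn (ex_mangoldt_neq0 R m).
  have qP m : (m <= q m)%N /\ mangoldt (q m) != 0 :> R.
    by rewrite /q; case: ex_minnP => n /andP[].
  (* The excess of the bound m q^r over m^(r+1), a function of r and m alone. *)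
  exists (fun m => m%:R * (q m)%:R ^+ r - m%:R ^+ r.+1); last first.
    move=> m H uH Vm; rewrite addrC subrK -natrX -natrM ler_nat -Vm.
    apply: omega0_le_prime_power => //; have [h1 h2] := qP #|vertices H| => //.
    exact: mangoldt_neq0 h2.
  apply/eqoP => eps eps0.
  (* By [expr1D_le], q <= (1 + e) m then yields q^r <= (1 + eps) m^r. *)
  pose e : R := Num.min 1 (eps / 2 ^+ r).
  have t0 : 0 < 2 ^+ r :> R by rewrite exprn_gt0.
  have e0 : 0 < e by rewrite lt_min ltr01 divr_gt0.
  have e1 : e <= 1 by rewrite ge_min lexx.
  have e2 : e * 2 ^+ r <= eps by rewrite -ler_pdivlMr // ge_min lexx orbT.
  have [x0 gap] := prime_power_gap e0.
  near=> m.
  have xm : (x0 <= m)%N by near: m; exact: nbhs_infty_ge.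
  have [n [mn nle] Ln] := gap m xm.
  have [mq _] := qP m.
  have qn : (q m <= n)%N.
    by rewrite /q; case: ex_minnP => k _; apply; rewrite ltnW.
  have h1 : m%:R ^+ r.+1 <= m%:R * (q m)%:R ^+ r :> R.
    by rewrite exprS ler_wpM2l // lerXn2r ?nnegrE // ler_nat.
  have h2 : m%:R * (q m)%:R ^+ r <= m%:R * (((1 + e) * m%:R) ^+ r) :> R.
    rewrite ler_wpM2l // lerXn2r ?nnegrE //; last first.
      by apply: le_trans nle; rewrite ler_nat.
    by rewrite mulr_ge0 // addr_ge0 // ltW.
  rewrite ger0_norm ?subr_ge0 // ger0_norm ?exprn_ge0 //.
  rewrite lerBlDr (le_trans h2) // exprMn mulrCA -exprS.
  have h3 : (1 + e) ^+ r <= eps + 1.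
    have e01 : 0 <= e <= 1 by rewrite ltW.
    by rewrite (le_trans (expr1D_le r e01)) //; lra.
  by rewrite (le_trans (ler_wpM2r _ h3)) ?exprn_ge0 // mulrDl mul1r.
- exists ((4 ^ r * (2 * r * r`!))%:R^-1) => //.
    by rewrite invr_gt0 ltr0n !muln_gt0 expn_gt0 hr fact_gt0.
  near=> m.
  have rm : (8 * r + 8 <= m)%N by near: m; exact: nbhs_infty_ge.
  rewrite mulrC ler_pdivrMr ?ltr0n ?muln_gt0 ?expn_gt0 ?hr ?fact_gt0 //.
  by rewrite -natrX -natrM ler_nat mulnC omega0_complete_ge_exp.
Unshelve. all: by end_near.
Qed.
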